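(* Let $W_{\boldsymbol\lambda}\in \boldsymbol B(\ell^2)$ be a CPD unilateral weighted shift and $(\mathfrak b,\mathfrak c, \nu)$ be its scalar representing triplet with $\mathfrak b \geqslant 0$, and let $\vartheta:=\sup\operatorname{supp}\nu$. Assume that at least one of the following conditions is satisfied: (i) $\mathfrak b + \mathfrak c \geqslant 1$, $2\mathfrak c + \nu(\mathbb R_+)(1 - \mathfrak c) \geqslant \mathfrak b$, $\nu(\mathbb R_+)\geqslant 1$ and $\inf\operatorname{supp}\nu \geqslant 2(1+\mathfrak c)$, (ii) there exists $t \in (0, \infty)$ such that $\mathfrak b + \mathfrak c + \nu(\mathbb R_+)\,t (1 + t) \geqslant 1$, $2\mathfrak c + \nu(\mathbb R_+)\big(1 - 2t -\frac{3}{2}t^2\big) \geqslant \mathfrak b$, $\nu(\mathbb R_+)\,t(2+t) \geqslant 2 \mathfrak c$ and $\inf\operatorname{supp}\nu \geqslant 2+t$, (iii) there exist $t \in (0, \infty)$ and $\tau \in (0, 1)$ such that (iii-a) $\mathfrak b + \mathfrak c \geqslant \tau$, $2\mathfrak c + \nu(\mathbb R_+)\big(1 - \frac{t}{2}\big) \geqslant \tau \mathfrak b$ and $\nu(\mathbb R_+)\, t \geqslant 2 \tau \mathfrak c$, (iii-b) $\mathfrak b + \mathfrak c \leqslant \vartheta -1$, $2\mathfrak c + \nu(\mathbb R_+) \leqslant (\vartheta -1) \mathfrak b$, $(1-\tau)\vartheta < 1$ and $\inf\operatorname{supp}\nu \geqslant 1+\tau + t$. Then $W_{\boldsymbol\lambda}$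 is of type III and is similar to a subnormal unilateral weighted shift. Moreover, if at least one of the following conditions holds: (a) $1 - \int_{(1,\vartheta]}\frac{1}{(x-1)^2}\,\mathrm d \nu(x) < \int_{[0,1)} \frac{1}{(x-1)^2}\,\mathrm d \nu(x) \leqslant \infty$, (b) $\mathfrak b \neq \int_{\mathbb R_+} \frac{1}{x-1}\,\mathrm d \nu(x)$, (c) $\mathfrak c > 0$, then $W_{\boldsymbol\lambda}$ is not subnormal.
   Context: $\mathbb Z_+=\{0,1,2,\dots\}$, $\mathbb R_+=[0,\infty)$; $\boldsymbol B(\mathcal H,\mathcal K)$ denotes bounded linear operators between complex Hilbert spaces, $\boldsymbol B(\mathcal H)=\boldsymbol B(\mathcal H,\mathcal H)$; $\{e_n\}_{n=0}^\infty$ is the standard orthonormal basis of $\ell^2=\ell^2(\mathbb Z_+)$. Unilateral weighted shift: for a bounded sequence $\boldsymbol\lambda=\{\lambda_n\}_{n=0}^\infty\subseteq(0,\infty)$, $W_{\boldsymbol\lambda}\in\boldsymbol B(\ell^2)$ is the operator with $W_{\boldsymbol\lambda}e_n=\lambda_n e_{n+1}$, $n\in\mathbb Z_+$. Put $\hat\lambda_0=1$ and $\hat\lambda_n=\lambda_0^2\cdots\lambda_{n-1}^2$ for $n\geqslant1$. CPD: $T\in\boldsymbol B(\mathcal H)$ is conditionally positive definite (CPD) if for every $h\in\mathcal H$ the sequence $\gamma_n=\|T^nh\|^2$ satisfies $\sum_{i,j=0}^k\gamma_{i+j}\alpha_i\bar\alpha_j\geqslant0$ for all finite complex sequences $\alpha_0,\dots,\alpha_k$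 with $\sum_{j=0}^k\alpha_j=0$. Scalar representing triplet: let $Q_0=Q_1=0$ and $Q_n(x)=\sum_{j=0}^{n-2}(n-j-1)x^j$ for $n\geqslant2$. It is known that $W_{\boldsymbol\lambda}$ is CPD if and only if there are $\mathfrak b\in\mathbb R$, $\mathfrak c\in\mathbb R_+$ and a compactly supported finite positive Borel measure $\nu$ on $\mathbb R_+$ with $\nu(\{1\})=0$ such that $\hat\lambda_n=1+\mathfrak bn+\mathfrak cn^2+\int_{\mathbb R_+}Q_n\,\mathrm d\nu$ for all $n\in\mathbb Z_+$; the triplet $(\mathfrak b,\mathfrak c,\nu)$ is then unique and is called the scalar representing triplet of $W_{\boldsymbol\lambda}$. Types: a CPD unilateral weighted shift with scalar representing triplet $(\mathfrak b,\mathfrak c,\nu)$ is of type I if $\nu=0$ and $\mathfrak c=0$; of type II if $\operatorname{supp}\nu=\{0\}$ and $\mathfrak c=0$; of type III if $\operatorname{supp}\nu\nsubseteq\{0\}$ or $\mathfrak c\neq0$. Operators $A\in\boldsymbol B(\mathcal H)$, $B\in\boldsymbol B(\mathcal K)$ are similar if $YA=BY$ for some bijective $Y\in\boldsymbol B(\mathcal H,\mathcal K)$. *)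

(* Defs.v *)
From HB Require Import structures.
From mathcomp Require Import all_boot all_order all_algebra.
From mathcomp Require Import all_classical all_reals all_analysis.
From mathcomp Require Import complex ring lra.

Set Implicit Arguments.
Unset Strict Implicit.
Unset Printing Implicit Defensive.

Import Order.TTheory GRing.Theory Num.Theory.
Import numFieldNormedType.Exports.

Local Open Scope classical_set_scope.
Local Open Scope ring_scope.
Local Open Scope complex_scope.

Section norm.
Variables (R : realType) (U : lmodType R[i]) (form : {dot U for Num.conj}).

(* The norm is real-valued; [form x x] is a nonnegative element of [R[i]],
   hence has zero imaginary part. *)
Definition dotnorm (x : U) : R := Num.sqrt (complex.Re (form x x)).

Definition dotcomplete :=
  forall u : nat -> U,
    (forall e : R, 0 < e -> exists N : nat, forall m n : nat,
       (N <= m)%N -> (N <= n)%N -> dotnorm (u m - u n) < e) ->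
    exists l : U, dotnorm (u n - l) @[n --> \oo] --> (0 : R).

End norm.

Record hilbertSpace (R : realType) := HilbertSpace {
  hilbert_sort :> lmodType R[i] ;
  inner : {dot hilbert_sort for Num.conj} ;
  hilbert_complete : dotcomplete inner }.

Definition hnorm (R : realType) (H : hilbertSpace R) (x : H) : R :=
  dotnorm (inner H) x.

Record boundedOp (R : realType) (H K : hilbertSpace R) := BoundedOp {
  bop_fun :> {linear H -> K} ;
  bop_bounded : exists M : R, forall x : H, hnorm (bop_fun x) <= M * hnorm x }.

Section ell2.
Variable R : realType.
Implicit Types z w : R[i].

Definition sqmod z : R := complex.Re z ^+ 2 + complex.Im z ^+ 2.

Definition ell2_pred : {pred nat -> R[i]} :=
  [pred f : nat -> R[i] | `[< cvgn (series (fun n => sqmod (f n))) >]].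

Lemma sqmod_ge0 z : 0 <= sqmod z.
Proof. by rewrite addr_ge0 ?sqr_ge0. Qed.

Lemma sqmodD z w : sqmod (z + w) <= 2 * sqmod z + 2 * sqmod w.
Proof.
case: z w => [a b] [c d]; rewrite /sqmod /= -subr_ge0.
have -> : 2 * (a ^+ 2 + b ^+ 2) + 2 * (c ^+ 2 + d ^+ 2)
   - ((a + c) ^+ 2 + (b + d) ^+ 2) = (a - c) ^+ 2 + (b - d) ^+ 2.
  by rewrite !sqrrD !sqrrN !mulrN; ring.
by rewrite addr_ge0 ?sqr_ge0.
Qed.

Lemma sqmodM z w : sqmod (z * w) = sqmod z * sqmod w.
Proof. by case: z w => [a b] [c d]; rewrite /sqmod /=; ring. Qed.

Lemma sqmod_eq0 z : (sqmod z == 0) = (z == 0).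
Proof.
by case: z => a b; rewrite /sqmod /= paddr_eq0 ?sqr_ge0 // !sqrf_eq0 eq_complex.
Qed.

Lemma ell2_predP (f : nat -> R[i]) :
  reflect (cvgn (series (fun n => sqmod (f n)))) (f \in ell2_pred).
Proof. exact: asboolP. Qed.

Lemma ell2_submod_closed : submod_closed ell2_pred.
Proof.
split=> [|a f g].
  apply/ell2_predP.
  have -> : (fun n => sqmod ((0 : nat -> R[i]) n)) = fun=> 0.
    by apply/funext => n; apply/eqP; rewrite sqmod_eq0.
  rewrite (_ : series _ = fun=> 0); first by apply: cvgP; exact: cvg_cst.
  by apply/funext => n; rewrite seriesEnat /= big1.
move=> /ell2_predP cf /ell2_predP cg; apply/ell2_predP.
apply: (@series_le_cvg _ _
  ((2 * sqmod a) *: (fun n => sqmod (f n)) + 2 *: (fun n => sqmod (g n)))).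
- by move=> n; exact: sqmod_ge0.
- by move=> n; rewrite addr_ge0 // mulr_ge0 ?mulr_ge0 ?sqmod_ge0.
- by move=> n; apply: le_trans (sqmodD _ _) _; rewrite sqmodM mulrA.
- by apply: is_cvg_seriesD; exact: is_cvg_seriesZ.
Qed.

HB.instance Definition _ := GRing.isSubmodClosed.Build _ _ ell2_pred
  ell2_submod_closed.

Record ell2_type := Ell2 { ell2_fun :> nat -> R[i]; _ : ell2_fun \in ell2_pred }.

HB.instance Definition _ := [isSub for ell2_fun].
HB.instance Definition _ := [Choice of ell2_type by <:].
HB.instance Definition _ := [SubChoice_isSubLmodule of ell2_type by <:].

Implicit Types f g : ell2_type.

Lemma ell2P (f : ell2_type) : cvgn (series (fun n => sqmod (f n))).
Proof. exact/ell2_predP/(valP f). Qed.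

Definition csummable (s : nat -> R[i]) :=
  cvgn (series (fun n => complex.Re (s n))) /\
  cvgn (series (fun n => complex.Im (s n))).

(* A complex series is summed componentwise. *)
Definition csum (s : nat -> R[i]) : R[i] :=
  limn (series (fun n => complex.Re (s n))) +i*
  limn (series (fun n => complex.Im (s n))).

Lemma csumB s t : csummable s -> csummable t ->
  csum (fun n => s n - t n) = csum s - csum t.
Proof.
move=> [sr si] [tr ti]; rewrite /csum.
have -> : (fun n => complex.Re (s n - t n)) =
  (fun n => complex.Re (s n)) - (fun n => complex.Re (t n)).
  by apply/funext => n; rewrite !fctE; case: (s n) (t n) => [? ?] [? ?].
have -> : (fun n => complex.Im (s n - t n)) =
  (fun n => complex.Im (s n)) - (fun n => complex.Im (t n)).
  by apply/funext => n; rewrite !fctE; case: (s n) (t n) => [? ?] [? ?].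
by rewrite !lim_seriesB.
Qed.

Lemma csumZ a s : csummable s -> csum (fun n => a * s n) = a * csum s.
Proof.
case: a => a b [sr si]; rewrite /csum.
have -> : (fun n => complex.Re ((a +i* b) * s n)) =
  a *: (fun n => complex.Re (s n)) - b *: (fun n => complex.Im (s n)).
  by apply/funext => n; rewrite !fctE; case: (s n) => [? ?].
have -> : (fun n => complex.Im ((a +i* b) * s n)) =
  a *: (fun n => complex.Im (s n)) + b *: (fun n => complex.Re (s n)).
  by apply/funext => n; rewrite !fctE; case: (s n) => [? ?].
rewrite lim_seriesB ?lim_seriesD; try exact: is_cvg_seriesZ.
by rewrite !lim_seriesZ.
Qed.

Lemma csum_conj s : csummable s -> csum (fun n => (s n)^*) = (csum s)^*.
Proof.
move=> [sr si]; rewrite /csum /=.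
have -> : (fun n => complex.Re ((s n)^*)) = (fun n => complex.Re (s n)).
  by apply/funext => n; case: (s n).
have -> : (fun n => complex.Im ((s n)^*)) = - (fun n => complex.Im (s n)).
  by apply/funext => n; rewrite !fctE; case: (s n).
by rewrite lim_seriesN.
Qed.

Lemma mulJ_le z w :
  `|complex.Re (z * w^*)| <= sqmod z + sqmod w /\
  `|complex.Im (z * w^*)| <= sqmod z + sqmod w.
Proof.
case: z w => [a b] [c d]; rewrite /sqmod /= !ler_norml.
have := sqr_ge0 (a - c); have := sqr_ge0 (b - d).
have := sqr_ge0 (a + c); have := sqr_ge0 (b + d).
have := sqr_ge0 (a - d); have := sqr_ge0 (b - c).
have := sqr_ge0 (a + d); have := sqr_ge0 (b + c).
by move=> *; split; apply/andP; split; nra.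
Qed.

Lemma csummable_dot (f g : ell2_type) : csummable (fun n => f n * (g n)^*).
Proof.
have cfg : cvgn (series ((fun n => sqmod (f n)) + (fun n => sqmod (g n)))).
  by apply: is_cvg_seriesD; exact: ell2P.
have fg0 n : 0 <= ((fun n => sqmod (f n)) + (fun n => sqmod (g n))) n.
  by rewrite addr_ge0 ?sqmod_ge0.
split; apply: normed_cvg; apply: (series_le_cvg _ fg0 _ cfg) => n //=.
- by have [] := mulJ_le (f n) (g n).
- by have [] := mulJ_le (f n) (g n).
Qed.

Definition ell2_dot (f g : ell2_type) : R[i] := csum (fun n => f n * (g n)^*).

Lemma ell2_dotC f g : ell2_dot f g = (ell2_dot g f)^*.
Proof.
rewrite /ell2_dot -csum_conj; last exact: csummable_dot.
by congr csum; apply/funext => n; rewrite rmorphM /= conjcK mulrC.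
Qed.

Lemma ell2_dotBl g : zmod_morphism (ell2_dot ^~ g).
Proof.
move=> f f'; rewrite /ell2_dot -csumB; try exact: csummable_dot.
by congr csum; apply/funext => n; rewrite -mulrBl.
Qed.

Lemma ell2_dotZl g : scalable_for *%R (ell2_dot ^~ g).
Proof.
move=> a f; rewrite /ell2_dot -csumZ; last exact: csummable_dot.
by congr csum; apply/funext => n; rewrite mulrA.
Qed.

Lemma ell2_dotBr f : zmod_morphism (ell2_dot f).
Proof.
by move=> g g'; rewrite !(ell2_dotC f) ell2_dotBl rmorphB.
Qed.

Lemma ell2_dotZr f : scalable_for (Num.conj \; *%R) (ell2_dot f).
Proof.
by move=> a g; rewrite !(ell2_dotC f) ell2_dotZl rmorphM.
Qed.

HB.instance Definition _ := isBilinear.Build _ ell2_type ell2_type _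
  *%R (Num.conj \; *%R) ell2_dot ell2_dotBl ell2_dotBr ell2_dotZl ell2_dotZr.

Lemma ell2_dot_herm f g : ell2_dot f g = (-1) ^+ false * Num.conj (ell2_dot g f).
Proof. by rewrite mul1r ell2_dotC. Qed.

HB.instance Definition _ := isHermitianSesquilinear.Build _ ell2_type
  false Num.conj ell2_dot ell2_dot_herm.

Lemma ell2_dotE f :
  ell2_dot f f = (limn (series (fun n => sqmod (f n))))%:C.
Proof.
have E n : f n * (f n)^* = (sqmod (f n))%:C.
  case: (f n) => a b; rewrite /sqmod; apply/eqP; rewrite eq_complex /=.
  by apply/andP; split; apply/eqP; ring.
rewrite /ell2_dot; under eq_fun do rewrite E.
rewrite /csum /=; congr (_ +i* _).
rewrite (_ : series _ = fun=> 0); first exact: lim_cst.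
by apply/funext => n; rewrite seriesEnat /= big1.
Qed.

Lemma sqmod_series_le (f : ell2_type) n :
  series (fun n => sqmod (f n)) n <= limn (series (fun n => sqmod (f n))).
Proof.
apply: nondecreasing_cvgn_le; last exact: ell2P.
by apply: nondecreasing_series => k _ _; exact: sqmod_ge0.
Qed.

Lemma sqmod_le (f : ell2_type) n :
  sqmod (f n) <= limn (series (fun n => sqmod (f n))).
Proof.
apply: le_trans (sqmod_series_le f n.+1).
rewrite seriesEnat /= big_nat_recr //= lerDr.
by apply: sumr_ge0 => k _; exact: sqmod_ge0.
Qed.

Lemma ell2_dot_gt0 f : f != 0 -> 0 < ell2_dot f f.
Proof.
move=> f0; rewrite ell2_dotE ltcE /= eqxx /= lt_neqAle eq_sym.
apply/andP; split; last exact: le_trans (sqmod_ge0 _) (sqmod_le f 0).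
apply: contra f0 => /eqP L0; apply/eqP/val_inj/funext => n /=.
apply/eqP; rewrite -sqmod_eq0 eq_le sqmod_ge0 andbT -L0; exact: sqmod_le.
Qed.

HB.instance Definition _ := isDotProduct.Build _ ell2_type ell2_dot ell2_dot_gt0.

Local Notation sqnorm f := (limn (series (fun n => sqmod (f n)))).

Lemma ell2_normE f : dotnorm ell2_dot f = Num.sqrt (sqnorm f).
Proof. by congr Num.sqrt; exact: (congr1 (@complex.Re R) (ell2_dotE f)). Qed.

Lemma sqnorm_ge0 f : 0 <= sqnorm f.
Proof. exact: le_trans (sqmod_ge0 _) (sqmod_le f 0). Qed.

Lemma ell2_normlt f (e : R) : 0 < e ->
  dotnorm ell2_dot f < e -> sqnorm f < e ^+ 2.
Proof.
move=> e0; rewrite ell2_normE => fe; rewrite -(sqr_sqrtr (sqnorm_ge0 f)).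
by rewrite ltr_pXn2r // nnegrE ?sqrtr_ge0 // ltW.
Qed.

Lemma ell2_complete : dotcomplete ell2_dot.
Proof.
move=> u cu.
have {}cu (e : R) : 0 < e -> exists N : nat, forall m n : nat,
    (N <= m)%N -> (N <= n)%N -> sqnorm (u m - u n) < e ^+ 2.
  move=> e0; have [N HN] := cu e e0; exists N => m n Nm Nn.
  by apply: ell2_normlt => //; exact: HN.
have cR k : cvgn (fun n => complex.Re (u n k)).
  apply/cauchy_cvgP/cauchy_exP => e e0; have [N HN] := cu e e0.
  exists (complex.Re (u N k)); exists N => // n /= Nn.
  change (`|complex.Re (u N k) - complex.Re (u n k)| < e).
  rewrite -ltr_sqr ?nnegrE ?normr_ge0 ?(ltW e0) // real_normK ?num_real //.
  apply: le_lt_trans (HN N n (leqnn _) Nn); apply: le_trans (sqmod_le _ k).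
  rewrite (_ : (u N - u n) k = u N k - u n k) // /sqmod.
  case: (u N k) (u n k) => [a b] [c d] /=.
  by rewrite lerDl sqr_ge0.
have cI k : cvgn (fun n => complex.Im (u n k)).
  apply/cauchy_cvgP/cauchy_exP => e e0; have [N HN] := cu e e0.
  exists (complex.Im (u N k)); exists N => // n /= Nn.
  change (`|complex.Im (u N k) - complex.Im (u n k)| < e).
  rewrite -ltr_sqr ?nnegrE ?normr_ge0 ?(ltW e0) // real_normK ?num_real //.
  apply: le_lt_trans (HN N n (leqnn _) Nn); apply: le_trans (sqmod_le _ k).
  rewrite (_ : (u N - u n) k = u N k - u n k) // /sqmod.
  case: (u N k) (u n k) => [a b] [c d] /=.
  by rewrite lerDr sqr_ge0.
pose f : nat -> R[i] := fun k => limn (fun n => complex.Re (u n k)) +i*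
                                 limn (fun n => complex.Im (u n k)).
have cf n K : series (fun k => sqmod (u n k - u m k)) K @[m --> \oo] -->
              series (fun k => sqmod (u n k - f k)) K.
  have ck k : sqmod (u n k - u m k) @[m --> \oo] --> sqmod (u n k - f k).
    have E z w : sqmod (z - w) =
        (complex.Re z - complex.Re w) * (complex.Re z - complex.Re w) +
        (complex.Im z - complex.Im w) * (complex.Im z - complex.Im w).
      by case: z w => [? ?] [? ?].
    under eq_fun do rewrite E; rewrite E.
    by apply: cvgD; apply: cvgM; apply: cvgB;
      (exact: cvg_cst || exact: cR || exact: cI).
  rewrite /series /=; elim: K => [|K IH].
    by under eq_fun do rewrite big_geq //; rewrite big_geq //; exact: cvg_cst.
  under eq_fun do rewrite big_nat_recr //=.
  by rewrite big_nat_recr //=; apply: cvgD; [exact: IH | exact: ck].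
have bf (e : R) : 0 < e -> exists N : nat, forall n, (N <= n)%N -> forall K,
    series (fun k => sqmod (u n k - f k)) K <= e ^+ 2.
  move=> e0; have [N HN] := cu e e0; exists N => n Nn K.
  rewrite -(cvg_lim (@Rhausdorff R) (cf n K)).
  apply: limr_le; first by apply: cvgP; exact: cf.
  exists N => // m /= Nm; apply: ltW; apply: le_lt_trans (HN n m Nn Nm).
  exact: (sqmod_series_le (u n - u m)).
have nd n : nondecreasing_seq (series (fun k => sqmod (u n k - f k))).
  by apply: nondecreasing_series => k _ _; exact: sqmod_ge0.
have mf : f \in ell2_pred.
  have [N HN] := bf 1 ltr01.
  have mNf : (fun k => u N k - f k) \in ell2_pred.
    apply/ell2_predP; apply: nondecreasing_is_cvgn; first exact: nd.
    by exists (1 ^+ 2) => _ [K _ <-]; exact: HN.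
  have -> : f = (u N : nat -> R[i]) - (fun k => u N k - f k).
    by apply/funext => k; rewrite !fctE opprB addrC subrK.
  by rewrite rpredB //; exact: (valP (u N)).
exists (Ell2 mf); apply/cvgrPdist_le => e e0.
have [N HN] := bf e e0; exists N => // n /= Nn.
rewrite sub0r normrN ger0_norm ?sqrtr_ge0 // ell2_normE.
rewrite -[e](@gtr0_norm R) // -sqrtr_sqr; apply: ler_wsqrtr.
apply: limr_le; first exact: ell2P.
by apply: nearW => K; exact: HN.
Qed.

Definition ell2 : hilbertSpace R := HilbertSpace ell2_complete.

Definition ell2_basis_fun (n : nat) : nat -> R[i] := fun k => (k == n)%:R.

Lemma ell2_basis_subproof n : ell2_basis_fun n \in ell2_pred.
Proof.
apply/ell2_predP; apply: nondecreasing_is_cvgn.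
  by apply: nondecreasing_series => k _ _; exact: sqmod_ge0.
exists 1 => _ [K _ <-]; rewrite seriesEnat /=.
have E k : sqmod (ell2_basis_fun n k) = (k == n)%:R.
  by rewrite /sqmod /ell2_basis_fun; case: (k == n);
    rewrite /= ?expr1n ?expr0n /= addr0.
under eq_bigr do rewrite E.
rewrite big_mkord; have [nK|Kn] := ltnP n K; last first.
  by rewrite big1 // => k _; rewrite ltn_eqF // (leq_trans _ Kn).
rewrite (bigD1 (Ordinal nK)) //= eqxx big1 ?addr0 // => k.
by rewrite -val_eqE /= => /negbTE ->.
Qed.

Definition ell2_basis (n : nat) : ell2 := Ell2 (ell2_basis_subproof n).

End ell2.

Section operators.
Variable R : realType.
Implicit Types H K : hilbertSpace R.

Definition normal_op K (N : boundedOp K K) :=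
  exists N' : boundedOp K K,
    (forall x y : K, inner K (N x) y = inner K x (N' y)) /\
    (forall x : K, N (N' x) = N' (N x)).

(* The inclusion of [H] in the larger space is an isometric embedding [V]. *)
Definition subnormal H (T : boundedOp H H) :=
  exists (K : hilbertSpace R) (V : {linear H -> K}) (N : boundedOp K K),
    [/\ isometry (inner K) (inner H) V, normal_op N &
        forall x : H, N (V x) = V (T x)].

Definition similar_op H K (A : boundedOp H H) (B : boundedOp K K) :=
  exists Y : boundedOp H K,
    bijective Y /\ forall x : H, Y (A x) = B (Y x).

Definition cpd_op H (T : boundedOp H H) :=
  forall (h : H) (k : nat) (a : 'I_k.+1 -> R[i]),
    \sum_(j < k.+1) a j = 0 ->
    0 <= \sum_(i < k.+1) \sum_(j < k.+1)
           (hnorm (iter (i + j)%N T h) ^+ 2)%:C * a i * (a j)^*.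

Definition weighted_shift (lambda : nat -> R)
    (W : boundedOp (ell2 R) (ell2 R)) :=
  [/\ forall n, 0 < lambda n,
      exists M : R, forall n, lambda n <= M &
      forall n, W (ell2_basis R n) = (lambda n)%:C *: ell2_basis R n.+1].

End operators.

Section triplet.
Variable R : realType.
Implicit Types (lambda : nat -> R) (b c : R).
Implicit Types nu : {finite_measure set (measurableTypeR R) -> \bar R}.

Definition lambda_hat lambda (n : nat) : R := \prod_(i < n) lambda i ^+ 2.

(* The index range is empty for [n = 0] and [n = 1]; in it, the natural number
   subtraction is not truncated. *)
Definition Qpoly (n : nat) (x : R) : R :=
  \sum_(j < n.-1) (n - j - 1)%N%:R * x ^+ j.

Definition msupport nu : set R :=
  [set x | forall U : set R, open_nbhs x U -> (0 < nu U)%E].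

(* The real [sup] and [inf] of the empty set are junk values, relevant only for
   [nu = 0]. *)
Definition supp_sup nu : R := sup (msupport nu).

Definition supp_inf nu : R := inf (msupport nu).

Definition mass nu : R := fine (nu `[(0 : R), +oo[%classic).

(* A measure on [0, +oo[ is encoded as a measure on the line vanishing on
   the negative half-line. *)
Definition scalar_triplet lambda b c nu :=
  [/\ 0 <= c,
      nu `]-oo, (0 : R)[%classic = 0%E,
      compact (msupport nu),
      nu [set 1] = 0%E &
      forall n : nat, (lambda_hat lambda n)%:E =
        ((1 + b * n%:R + c * n%:R ^+ 2)%:E +
         \int[nu]_(x in `[0%R, +oo[) (Qpoly n x)%:E)%E].

Definition shift_type_III lambda b c nu :=
  scalar_triplet lambda b c nu /\ (~ (msupport nu `<=` [set 0]) \/ c != 0).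

End triplet.

(* Main.v *)
Require Import Defs.
From HB Require Import structures.
From mathcomp Require Import all_boot all_order all_algebra.
From mathcomp Require Import all_classical all_reals all_analysis.
From mathcomp Require Import measurable_realfun complex ring lra.

Set Implicit Arguments.
Unset Strict Implicit.
Unset Printing Implicit Defensive.

Import Order.TTheory GRing.Theory Num.Theory.
Import numFieldNormedType.Exports.

Local Open Scope classical_set_scope.
Local Open Scope ring_scope.

(** Each of the three hypotheses forces [a := inf supp nu > 1], so that [nu] lives
    at a positive distance from 1. Put [E p := \int p(x) / (x - 1) ^ 2 dnu] for
    polynomials [p], the integral being over [[a, sup supp nu]]. As
    [(x - 1) ^ 2 Q_n(x) = x ^ n - 1 - n (x - 1)], the representing triplet says
      [hat lambda_n = A0 + B n + c n ^ 2 + s_n],  [s_n := E X^n],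
    with [A0 = 1 - E 1] and [B = b - E (X - 1)]. The three conditions for the
    failure of subnormality read [A0 < 0], [B <> 0] and [c > 0].

    Similarity. The sequence [s_n] grows at least like [a ^ n], so
    [hat lambda_n] and [s_n] are comparable: their quotients are bounded above
    and away from 0. Two weighted shifts whose moments are comparable are
    similar through a diagonal operator (shift_similar), so a subnormal
    shift is needed whose moments are comparable with [s_n]. The shift with
    moments [s_n] would do, but its normal extension acts on the square
    integrable functions for the measure [nu / (x - 1) ^ 2]. A discrete
    measure is enough: since [s] is log-convex, it is comparable with a sum
    [p_n = \sum_k W_k r_k ^ n] of exponentials of suitably spaced tangents of
    [log s] (logconvex_power_sum). The shift with moments [p_n] has an explicit
    normal extension, an orthogonal sum of multiples of the bilateral shift
    (power_sum_shift_subnormal).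

    Failure of subnormality. If [W] is subnormal with normal extension [N],
    then [hat lambda_(i + j)] is the inner product of the vectors
    [(N* N) ^ i e_0] and [(N* N) ^ j e_0] (subnormal_hankel), so the linear
    functional
      [p |-> A0 p(1) + B p'(1) + c (p'(1) + p''(1)) + E p],
    which maps [X^n] to [hat lambda_n], is nonnegative on squares. Squares of
    polynomials that are tiny on [[a, sup supp nu]], where [E] lives, and have
    prescribed derivatives at 1 then give [c = 0], [B = 0] and [A0 >= 0]
    (moment_functional_rigid). *)

(** * Log-convex sequences and discrete power sums *)

Section LogConvex.
Variables (R : realType) (s : nat -> R) (th : R).
Hypothesis s_gt0 : forall n, 0 < s n.
Hypothesis s_logconvex : forall n, s n.+1 ^+ 2 <= s n * s n.+2.
Hypothesis s_growth : forall n, s n.+1 <= th * s n.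

Let q n := s n.+1 / s n.
Let w n := s n / q n ^+ n.
(** [T n] is the geometric sequence whose logarithm is a tangent of [log s] at
    [n], namely the line through its values at [n] and [n + 1]. *)
Let T n m := w n * q n ^+ m.
(** The tangents at [n] and [m] are far apart: each is at most half of [s], and
    hence of the other tangent, at the other's point of contact. *)
Let sep n m := 2 * T n m <= s m /\ 2 * T m n <= s n.

Let q_gt0 n : 0 < q n. Proof. by rewrite divr_gt0. Qed.
Let qX_gt0 n m : 0 < q n ^+ m. Proof. by rewrite exprn_gt0. Qed.
Let w_gt0 n : 0 < w n. Proof. by rewrite divr_gt0. Qed.
Let T_gt0 n m : 0 < T n m. Proof. by rewrite mulr_gt0. Qed.
Let s_ge0 n : 0 <= s n. Proof. exact: ltW. Qed.
Let q_ge0 n : 0 <= q n. Proof. exact: ltW. Qed.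
Let qX_ge0 n m : 0 <= q n ^+ m. Proof. exact: ltW. Qed.
Let w_ge0 n : 0 <= w n. Proof. exact: ltW. Qed.
Let T_ge0 n m : 0 <= T n m. Proof. exact: ltW. Qed.
#[local] Hint Resolve s_ge0 q_gt0 qX_gt0 w_gt0 T_gt0 : core.
#[local] Hint Resolve q_ge0 qX_ge0 w_ge0 T_ge0 : core.
Let sS n : s n.+1 = q n * s n. Proof. by rewrite divfK // gt_eqF. Qed.
Let q_le n : q n <= th. Proof. by rewrite ler_pdivrMr. Qed.

Let q_homo : {homo q : m n / (m <= n)%N >-> m <= n}.
Proof.
apply: homo_leq => [x|y x z|n]; [exact: lexx | exact: le_trans |].
by rewrite /q ler_pdivrMr // mulrAC ler_pdivlMr // -expr2 mulrC.
Qed.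

Let qX_homo m n d : (m <= n)%N -> q m ^+ d <= q n ^+ d.
Proof. by move=> mn; apply: lerXn2r; rewrite ?nnegrE ?q_homo. Qed.

Let TD n m d : T n (m + d) = T n m * q n ^+ d.
Proof. by rewrite /T exprD mulrA. Qed.

Let T_self n : T n n = s n.
Proof. by rewrite /T /w divfK // gt_eqF. Qed.

Let s_geD n m d : (n <= m)%N -> q n ^+ d * s m <= s (m + d).
Proof.
move=> nm; elim: d => [|d IH]; first by rewrite expr0 mul1r addn0.
rewrite addnS sS exprS -mulrA; apply: ler_pM => //; first exact: mulr_ge0.
by apply: q_homo; rewrite (leq_trans nm) // leq_addr.
Qed.

Let s_leD n m d : (m + d <= n.+1)%N -> s (m + d) <= q n ^+ d * s m.
Proof.
elim: d => [|d IH] h; first by rewrite expr0 mul1r addn0.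
rewrite addnS sS exprS -mulrA; apply: ler_pM => //.
  by apply: q_homo; rewrite -ltnS -addnS.
by rewrite IH // ltnW // -addnS.
Qed.

Let T_le n m : T n m <= s m.
Proof.
case: (leqP n m) => [nm|/ltnW mn].
  by rewrite -(subnKC nm) TD T_self mulrC; exact: s_geD.
rewrite -(ler_pM2r (qX_gt0 n (n - m))) -TD subnKC // T_self mulrC.
by rewrite -{1}(subnKC mn); apply: s_leD; rewrite subnKC.
Qed.

Let sep_right j k x : (k <= x)%N -> (j <= k)%N -> sep j k -> 2 * T j x <= T k x.
Proof.
move=> kx jk [sjk _]; rewrite -(subnKC kx) !TD mulrA T_self.
by apply: ler_pM => //; [exact: mulr_ge0 | exact: qX_homo].
Qed.

Let sep_left j k x : (x <= j)%N -> (j <= k)%N -> sep j k -> 2 * T k x <= T j x.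
Proof.
move=> xj jk [_ skj]; rewrite -(ler_pM2r (qX_gt0 k (j - x))) -mulrA -TD subnKC //.
apply: le_trans skj _; rewrite -T_self -{2}(subnKC xj) TD.
by rewrite ler_pM2l // qX_homo.
Qed.

(** A pair that is not separated is covered by one of its two tangents: at the
    points in between, the quotient of [s] by a tangent is monotone. *)
Let cover n p x : (n <= x)%N -> (x <= p)%N -> ~ sep n p ->
  s x <= 2 * (T n x + T p x).
Proof.
move=> nx xp /not_andP[] /negP; rewrite -ltNge => h.
  rewrite mulrDr; apply: ler_wpDr; first exact: mulr_ge0.
  apply: ltW; rewrite -(ltr_pM2r (qX_gt0 n (p - x))) -mulrA -TD subnKC //.
  by apply: (le_lt_trans _ h); rewrite mulrC -{2}(subnKC xp); exact: s_geD.
rewrite mulrDr; apply: ler_wpDl; first exact: mulr_ge0.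
rewrite -(subnKC nx) TD mulrA mulrC.
apply: le_trans (_ : q p ^+ (x - n) * s n <= _).
  by apply: s_leD; rewrite subnKC // leqW.
by rewrite ler_pM2l // ltW.
Qed.

Let far_right n m m' : (n <= m)%N -> (m <= m')%N ->
  2 * T n m <= s m -> 2 * T n m' <= s m'.
Proof.
move=> nm mm' h; rewrite -(subnKC mm') TD mulrA.
apply: le_trans (_ : s m * q n ^+ (m' - m) <= _); first by rewrite ler_pM2r.
by rewrite mulrC; exact: s_geD.
Qed.

Let far_left n m m' : (n <= m)%N -> (m <= m')%N ->
  2 * T m n <= s n -> 2 * T m' n <= s n.
Proof.
move=> nm mm' h2; apply: (le_trans _ h2); rewrite ler_pM2l //.
have := T_le m' m; rewrite -(T_self m) -{1 3}(subnKC nm) !TD => h.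
rewrite -(ler_pM2r (qX_gt0 m' (m - n))); apply: le_trans h _.
by rewrite ler_pM2l // qX_homo.
Qed.

Let sep_far n m m' : (n <= m)%N -> (m <= m')%N -> sep n m -> sep n m'.
Proof.
move=> nm mm' [h1 h2]; split; first exact: far_right h1.
exact: far_left h2.
Qed.

Let w_homo : {homo w : m n / (m <= n)%N >-> n <= m}.
Proof.
apply: homo_leq => [x|y x z xy yz|n]; [exact: lexx | exact: le_trans yz xy |].
rewrite -(ler_pM2r (qX_gt0 n.+1 n.+1)) -/(T n.+1 n.+1) T_self.
have <- : T n n.+1 = s n.+1 by rewrite sS -addn1 TD T_self expr1 mulrC.
by rewrite ler_pM2l // qX_homo.
Qed.

(** The sequence [w] decreases. If it tends to 0, each tangent is eventually small
    compared with [s] and infinitely many of them are needed; otherwise [s] is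
    comparable with the powers of the limit of [q]. *)
Section Vanishing.
Hypothesis w_to0 : forall e, 0 < e -> exists n, w n < e.

Let w_to0' e n : 0 < e -> exists m, (n <= m)%N /\ w m < e.
Proof.
move=> /w_to0[m me]; exists (maxn n m); split; first exact: leq_maxl.
by apply: (le_lt_trans _ me); apply: w_homo; exact: leq_maxr.
Qed.

(** [q] cannot be constant from [n] on, for then [w] would be; and if
    [q n < q m0], the tangent at [m0] eventually dominates twice the tangent at
    [n]. *)
Let sep_exists1 n : exists m, (n <= m)%N /\ 2 * T n m <= s m.
Proof.
have [m0 [nm0 lt0]] : exists m, (n <= m)%N /\ q n < q m.
  have [m [nm wm]] := w_to0' n (w_gt0 n).
  exists m; split => //; rewrite lt_neqAle q_homo // andbT.
  apply/eqP => qE; move: wm; apply/negP; rewrite -leNgt.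
  rewrite -(ler_pM2r (qX_gt0 m m)) -/(T m m) T_self -qE; exact: T_le.
have d0 : 0 < w m0 / (2 * w n) by rewrite divr_gt0 // mulr_gt0.
have c0 : (fun k => (q n / q m0) ^+ k) @ \oo --> (0 : R).
  by apply: cvg_expr; rewrite gtr0_norm ?divr_gt0 // ltr_pdivrMr ?mul1r.
move/cvgrPdist_lt : c0 => /(_ _ d0)[N _ HN].
exists (maxn n N); split; first exact: leq_maxl.
apply: le_trans (T_le m0 _); have := HN (maxn n N) (leq_maxr _ _).
rewrite /= sub0r normrN ger0_norm; last first.
  by rewrite ltW // exprn_gt0 // divr_gt0.
have z0 : 0 < 2 * w n by rewrite mulr_gt0.
rewrite (ltr_pdivlMr _ _ z0) -(ltr_pM2r (qX_gt0 m0 (maxn n N))).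
rewrite mulrAC expr_div_n divfK ?gt_eqF // => h.
by rewrite mulrA mulrC ltW.
Qed.

Let sep_exists2 n : exists m, (n <= m)%N /\ 2 * T m n <= s n.
Proof.
have th0 : 0 < th by exact: lt_le_trans (q_gt0 0) (q_le 0).
have d0 : 0 < s n / (2 * th ^+ n) by rewrite divr_gt0 ?mulr_gt0 ?exprn_gt0.
have [m [nm wm]] := w_to0' n d0; exists m; split => //.
move: wm; rewrite ltr_pdivlMr ?mulr_gt0 ?exprn_gt0 // => /ltW; apply: le_trans.
rewrite mulrCA ler_pM2l // ler_pM2l //.
by apply: lerXn2r; rewrite ?nnegrE // ltW.
Qed.

(** [p] is the last point not separated from [n], but at least [n + 1]. Thus
    [n] and [p] together cover the interval between them, while two successive
    steps lead to a separated point. *)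
Let step n : exists p, [/\ (n < p)%N, sep n p.+1 &
  forall x, (n <= x)%N -> (x <= p)%N -> s x <= 2 * (T n x + T p x)].
Proof.
have ex : exists m, (n <= m)%N && `[< sep n m >].
  have [m1 [nm1 h1]] := sep_exists1 n; have [m2 [nm2 h2]] := sep_exists2 n.
  exists (maxn m1 m2); rewrite (leq_trans nm1) ?leq_maxl //=; apply/asboolP.
  by split; [apply: far_right h1; rewrite ?leq_maxl
            | apply: far_left h2; rewrite ?leq_maxr].
case: (ex_minnP ex) => m /andP[nm /asboolP sm] mmin.
have {}nm : (n < m)%N.
  rewrite ltn_neqAle nm andbT; apply/eqP => nE; case: sm.
  by rewrite -nE T_self mulr2n mulrDl mul1r; have := s_gt0 n; lra.
have nonsep p : (n <= p)%N -> (p < m)%N -> ~ sep n p.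
  by move=> np pm sp; have := mmin p; rewrite np asboolT // leqNgt pm => /(_ isT).
have [nm1|nm1] := leqP m n.+2.
  exists n.+1; split=> // [|x nx xn]; first by apply: sep_far nm1 sm; exact: ltnW.
  rewrite leq_eqVlt in xn; have : s x <= T n x + T n.+1 x.
    have [->|->] : x = n.+1 \/ x = n.
    - case/orP: xn => [/eqP->|xn]; [by left | right].
      by apply/eqP; rewrite eqn_leq nx andbT.
    - by rewrite T_self lerDr ltW.
    - by rewrite T_self lerDl ltW.
  by move=> h; apply: le_trans h _; rewrite ler_peMl ?ler1n // ltW // addr_gt0.
case: m nm nm1 sm mmin nonsep => // p nm nm1 sm _ nonsep.
exists p; split=> // [|x nx xp]; first exact: ltnW.
by apply: cover => //; apply: nonsep.
Qed.

(** At a point between [a k] and [a k.+1], the tangents at [a j] halve every two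
    steps as [j] moves away from [k] in either direction, so their sum is at
    most a constant times [s]. *)
Lemma logconvex_power_sum_vanishing : exists W r : nat -> R, exists C : R,
  [/\ forall k, 0 <= W k, forall k, 0 <= r k <= th, 0 < C &
   forall m, (forall K, \sum_(k < K) W k * r k ^+ m <= C * s m) /\
             (exists K, s m <= C * \sum_(k < K) W k * r k ^+ m)].
Proof.
have [nxt Hnxt] := choice step.
pose a k := iter k nxt 0%N.
have aS k : (a k < a k.+1)%N by have [] := Hnxt (a k).
have a_homo : {homo a : i j / (i <= j)%N >-> (i <= j)%N}.
  by apply: homo_leq => [x|y x z|n]; [exact: leqnn | exact: leq_trans | exact: ltnW].
have a_ge k : (k <= a k)%N by elim: k => // k IH; exact: leq_ltn_trans IH (aS k).
have sep2 k : sep (a k) (a k.+2).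
  have [h1 h2 _] := Hnxt (a k); apply: sep_far h2; first exact/leqW/ltnW.
  exact: (aS k.+1).
exists (fun k => w (a k)), (fun k => q (a k)), 8; split=> //.
  by move=> k; rewrite q_ge0 q_le.
move=> m.
have [k [akm mak]] : exists k, (a k <= m)%N /\ (m <= a k.+1)%N.
  have ex : exists k, (a k <= m)%N by exists 0%N.
  have bd k : (a k <= m)%N -> (k <= m)%N by exact: leq_trans.
  case: (ex_maxnP ex bd) => k km kmax; exists k; split => //.
  by rewrite leqNgt; apply/negP => /ltnW /kmax; rewrite ltnn.
pose t j := T (a j) m.
have t_ge0 j : 0 <= t j by exact: T_ge0.
have up j : (a j.+2 <= m)%N -> 2 * t j <= t j.+2.
  by move=> h; apply: sep_right (sep2 j) => //; apply: a_homo; exact/leqW/leqnSn.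
have dn j : (m <= a j)%N -> 2 * t j.+2 <= t j.
  by move=> h; apply: sep_left (sep2 j) => //; apply: a_homo; exact/leqW/leqnSn.
have t_le j : t j <= s m by exact: T_le.
have left_sum j : (a j <= m)%N -> \sum_(i < j.+1) t i <= 4 * s m.
  move=> ajm.
  suff : \sum_(i < j.+1) t i <= 2 * t j + (if j is i.+1 then 2 * t i else 0).
    move=> h; apply: le_trans h _; have := s_ge0 m.
    case: j ajm => [|j] _; first by have := t_le 0%N; lra.
    by have := t_le j; have := t_le j.+1; lra.
  elim: j ajm => [|j IH] ajm; first by rewrite big_ord1; have := t_ge0 0%N; lra.
  rewrite big_ord_recr /=; have {}IH := IH (leq_trans (ltnW (aS j)) ajm).
  by case: j IH ajm => [|j] IH ajm; [have := t_ge0 1%N | have := up j ajm]; lra.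
have right_sum d j : (m <= a j)%N -> \sum_(i < d) t (j + i)%N <= 4 * s m.
  move=> maj; suff : \sum_(i < d) t (j + i)%N <= 2 * t j + 2 * t j.+1.
    by move=> h; apply: le_trans h _; have := t_le j; have := t_le j.+1; lra.
  elim: d j maj => [|d IH] j maj.
    by rewrite big_ord0 addr_ge0 // mulr_ge0.
  rewrite big_ord_recl addn0.
  under eq_bigr do rewrite /= /bump /= add1n addnS -addSn.
  have := IH j.+1 (leq_trans maj (ltnW (aS j))); have := dn j maj; lra.
split=> [K|].
  have -> : \sum_(i < K) w (a i) * q (a i) ^+ m = \sum_(i < K) t i by [].
  apply: le_trans (_ : \sum_(i < k.+1 + K) t i <= _).
    rewrite -!(big_mkord xpredT t) (big_cat_nat (n := K) (p := (k.+1 + K)%N)) //=;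
      last exact: leq_addl.
    by rewrite lerDl sumr_ge0.
  rewrite big_split_ord /=.
  by have := left_sum k akm; have := right_sum K k.+1 mak; lra.
exists k.+2; have [_ _ /(_ m akm mak)] := Hnxt (a k).
rewrite -[T (nxt (a k)) m]/(t k.+1) -[T (a k) m]/(t k) => h.
have -> : \sum_(i < k.+2) w (a i) * q (a i) ^+ m = \sum_(i < k.+2) t i by [].
rewrite !big_ord_recr /=.
have : 0 <= \sum_(i < k) t i by apply: sumr_ge0.
by have := t_ge0 k; have := t_ge0 k.+1; lra.
Qed.

End Vanishing.

(** A log-convex sequence with bounded quotients is, up to bounded factors, the
    moment sequence of a discrete measure on [[0, th]]; [W] may vanish, so that
    finitely many atoms are allowed. *)
Lemma logconvex_power_sum : exists W r : nat -> R, exists C : R,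
  [/\ forall k, 0 <= W k, forall k, 0 <= r k <= th, 0 < C &
   forall m, (forall K, \sum_(k < K) W k * r k ^+ m <= C * s m) /\
             (exists K, s m <= C * \sum_(k < K) W k * r k ^+ m)].
Proof.
have [|/existsNP[e /not_implyP[e0 /forallNP we]]] :=
  pselect (forall e, 0 < e -> exists n, w n < e).
  exact: logconvex_power_sum_vanishing.
have {}we n : e <= w n by rewrite leNgt; apply/negP; exact: we.
have ubq : has_ubound (range q) by exists th => _ [n _ <-].
have cq : q @ \oo --> sup (range q) by exact: nondecreasing_cvgn.
set Q := sup _ in cq.
have qQ n : q n <= Q by apply: ub_le_sup => //; exists n.
have Q0 : 0 < Q by exact: lt_le_trans (q_gt0 0) (qQ 0).
exists (fun k => (k == 0)%:R), (fun=> Q), (s 0 + e^-1); split.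
- by [].
- move=> k; rewrite ltW //=; apply: ge_sup; first by exists (q 0); exists 0%N.
  by move=> _ [n _ <-].
- by rewrite addr_gt0 // invr_gt0.
move=> m.
have sumE K : \sum_(k < K.+1) (k == 0 :> nat)%:R * Q ^+ m = Q ^+ m.
  by rewrite big_ord_recl /= mul1r big1 ?addr0 // => i _; rewrite mul0r.
have C1 : s 0 <= s 0 + e^-1 by rewrite lerDl invr_ge0 ltW.
have C2 : e^-1 <= s 0 + e^-1 by rewrite lerDr.
have QX := exprn_gt0 m Q0.
have eQ : e * Q ^+ m <= s m.
  have cQ : (fun n => e * q n ^+ m) @ \oo --> e * Q ^+ m.
    by apply: cvgM; [exact: cvg_cst | exact: cvg_comp cq (@exprn_continuous _ m Q)].
  rewrite -(cvg_lim (@Rhausdorff R) cQ).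
  apply: limr_le; first by apply: cvgP; exact: cQ.
  by apply: nearW => n; apply: le_trans (T_le n m); rewrite ler_pM2r.
have sQ : s m <= s 0 * Q ^+ m.
  elim: m {sumE eQ QX} => [|m IH]; first by rewrite expr0 mulr1.
  rewrite sS exprS mulrCA; exact: ler_pM.
split=> [K|]; last first.
  by exists 1%N; rewrite sumE; apply: le_trans sQ _; rewrite ler_pM2r.
case: K => [|K]; first by rewrite big_ord0 mulr_ge0 ?ltW // (lt_le_trans _ C1).
rewrite sumE; apply: le_trans (_ : e^-1 * s m <= _); last by rewrite ler_pM2r.
by rewrite mulrC ler_pdivlMr // mulrC.
Qed.

End LogConvex.

Local Open Scope complex_scope.

(** * Operators on the sequence space *)

Lemma conj_realC (R : realType) (a : R) : Num.conj (a%:C : R[i]) = a%:C.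
Proof. by apply/eqP; rewrite eq_complex /= oppr0 !eqxx. Qed.

Section SequenceOperators.
Variable R : realType.
Implicit Types (f g : nat -> R[i]) (x y : ell2 R).

(** The squared norm of an arbitrary sequence as a sum over an unordered index
    set: unlike a series, it can be reindexed and regrouped freely. *)
Definition esqnorm f : \bar R := \esum_(i in [set: nat]) (sqmod (f i))%:E.

Lemma esqnormE f : esqnorm f = (\sum_(0 <= i <oo) (sqmod (f i))%:E)%E.
Proof. by rewrite /esqnorm nneseries_esumT // => n; rewrite lee_fin sqmod_ge0. Qed.

Lemma esqnorm_ell2 x :
  esqnorm (ell2_fun x) = (limn (series (fun n => sqmod (x n))))%:E.
Proof.
rewrite esqnormE -EFin_lim; last exact: ell2P.
by congr (limn _); apply/funext => n; rewrite /= sumEFin.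
Qed.

Lemma esqnorm_lty f : (esqnorm f < +oo)%E -> f \in @ell2_pred R.
Proof.
move=> h; apply/ell2_predP/nondecreasing_is_cvgn.
  by apply: nondecreasing_series => k _ _; exact: sqmod_ge0.
exists (fine (esqnorm f)) => _ [n _ <-].
rewrite -lee_fin fineK; last first.
  rewrite ge0_fin_numE //; apply: esum_ge0 => i _; rewrite lee_fin; exact: sqmod_ge0.
rewrite seriesEnat /= -sumEFin esqnormE; apply: nneseries_lim_ge => i _ _.
by rewrite lee_fin sqmod_ge0.
Qed.

Lemma hnorm_ell2 x : hnorm x = Num.sqrt (fine (esqnorm (ell2_fun x))).
Proof. by rewrite esqnorm_ell2; exact: ell2_normE. Qed.

Lemma inner_ell2 x : inner (ell2 R) x x = (fine (esqnorm (ell2_fun x)))%:C.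
Proof. by rewrite esqnorm_ell2; exact: ell2_dotE. Qed.

(** Boundedness needs checking on squared norms of sequences only; it also
    ensures that [F] does not leave the sequence space. *)
Lemma ell2_operator (F : (nat -> R[i]) -> nat -> R[i]) (M : R) :
  (forall (a : R[i]) f g n,
     F (fun k => a * f k + g k) n = a * F f n + F g n) ->
  0 <= M -> (forall f, esqnorm (F f) <= M%:E * esqnorm f)%E ->
  exists T : boundedOp (ell2 R) (ell2 R),
    forall x, ell2_fun (T x) = F (ell2_fun x).
Proof.
move=> Flin M0 FM.
have mem x : F (ell2_fun x) \in @ell2_pred R.
  apply: esqnorm_lty; apply: le_lt_trans (FM _) _.
  by rewrite esqnorm_ell2 -EFinM ltry.
pose G x : ell2 R := Ell2 (mem x).
have Glin : linear G.
  by move=> a x y; apply/val_inj/funext => n; exact: (Flin a (ell2_fun x)).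
pose GL : {linear ell2 R -> ell2 R} :=
  HB.pack_for {linear ell2 R -> ell2 R} G (GRing.isLinear.Build _ _ _ _ G Glin).
have Gbd : exists M : R, forall x, hnorm (GL x) <= M * hnorm x.
  exists (Num.sqrt M) => x; rewrite !hnorm_ell2 -sqrtrM //; apply: ler_wsqrtr.
  have := FM (ell2_fun x); rewrite -[F _]/(ell2_fun (GL x)) !esqnorm_ell2 /=.
  by rewrite -EFinM lee_fin.
by exists (BoundedOp Gbd) => x.
Qed.

End SequenceOperators.

(** * Polarization *)

Lemma polarization (R : realType) (H K : hilbertSpace R) (V : {linear H -> K}) :
  (forall x, inner K (V x) (V x) = inner H x x) ->
  isometry (inner K) (inner H) V.
Proof.
move=> Vx x y.
have D (L : hilbertSpace R) (u v : L) : inner L (u + v) (u + v) =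
    inner L u u + inner L v v + (inner L u v + (inner L u v)^*).
  by rewrite hnormD /= expr0 mul1r.
have E z : inner K (V x) (V z) + (inner K (V x) (V z))^* =
           inner H x z + (inner H x z)^*.
  by have := Vx (x + z); rewrite raddfD !D !Vx => /addrI.
have E1 := E y; have := E ('i *: y).
rewrite linearZ /= !linearZr_LR /=.
move: E1; case: (inner K _ _) (inner H _ _) => [a b] [c d].
move=> /eqP; rewrite eq_complex /= => /andP[/eqP h1 _].
move=> /eqP; rewrite eq_complex /= => /andP[/eqP h2 _].
by apply/eqP; rewrite eq_complex /=; apply/andP; split; apply/eqP; lra.
Qed.

(** * Weighted permutations and shifts *)

Section Weighted.
Variable R : realType.

Lemma sqmod_real (a : R) (z : R[i]) : sqmod (a%:C * z) = a ^+ 2 * sqmod z.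
Proof. by rewrite sqmodM /sqmod /= expr0n addr0. Qed.

Lemma esum_inj (T U : choiceType) (e : T -> U) (a : U -> \bar R) :
  injective e -> (forall u, ~ range e u -> a u = 0%E) ->
  \esum_(u in [set: U]) a u = \esum_(t in [set: T]) a (e t).
Proof.
move=> ei a0; rewrite -(reindex_esum setT (range e) e); last first.
  exact: inj_bij (in2W ei).
rewrite [RHS]esum_mkcond; apply: eq_esum => u _.
by case: ifPn => // /negP; rewrite inE => /a0.
Qed.

Lemma esqnorm_le (f g : nat -> R[i]) (M : R) :
  (forall n, sqmod (f n) <= M * sqmod (g n)) ->
  (esqnorm f <= M%:E * esqnorm g)%E.
Proof.
move=> fg; rewrite !esqnormE -nneseriesZl; last first.
  by move=> i _; rewrite lee_fin sqmod_ge0.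
apply: lee_nneseries => [i _ _|i _]; first by rewrite lee_fin sqmod_ge0.
by rewrite -EFinM lee_fin.
Qed.

Lemma esqnorm_comp (f : nat -> R[i]) (sg : nat -> nat) : bijective sg ->
  esqnorm (f \o sg) = esqnorm f.
Proof.
move=> sgb; rewrite /esqnorm [RHS](reindex_esum [set: nat] [set: nat] sg) //.
by rewrite setTT_bijective.
Qed.

(** With [sg] the identity these are the diagonal operators, with constant [v]
    the multiples of permutation operators. *)
Lemma weighted_comp_operator (v : nat -> R) (sg : nat -> nat) (M : R) :
  bijective sg -> 0 <= M -> (forall n, v n ^+ 2 <= M) ->
  exists T : boundedOp (ell2 R) (ell2 R),
    forall (x : ell2 R) n, T x n = (v n)%:C * x (sg n).
Proof.
move=> sgb M0 vM.
have [a f g n|f|T TE] := @ell2_operator R (fun f n => (v n)%:C * f (sg n)) M _ M0.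
- by rewrite mulrDr mulrCA.
- rewrite -(esqnorm_comp f sgb); apply: esqnorm_le => n.
  by rewrite sqmod_real ler_wpM2r // sqmod_ge0.
- by exists T => x n; rewrite TE.
Qed.

(** Composition with [sg] preserves norms, hence inner products; what is left of
    the two sides then agrees term by term. This avoids rearranging a series
    that is not of nonnegative terms. *)
Lemma weighted_comp_adjoint (v : nat -> R) (sg tau : nat -> nat)
    (T T' : boundedOp (ell2 R) (ell2 R)) :
  cancel sg tau -> cancel tau sg ->
  (forall (x : ell2 R) n, T x n = (v n)%:C * x (sg n)) ->
  (forall (x : ell2 R) n, T' x n = (v (tau n))%:C * x (tau n)) ->
  forall x y, inner (ell2 R) (T x) y = inner (ell2 R) x (T' y).
Proof.
move=> sgK tauK TE T'E x y.
have sgb : bijective sg by exists tau.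
have [U UE] := @weighted_comp_operator (fun=> 1) sg 1 sgb ler01
  (fun _ => eqbRL (expr_le1 (n := 2) isT ler01) (lexx _)).
have Uiso : isometry (inner (ell2 R)) (inner (ell2 R)) U.
  apply: polarization => z; rewrite !inner_ell2; do 2!congr (_ _).
  rewrite -(esqnorm_comp z sgb); congr esqnorm; apply/funext => n.
  by rewrite UE mul1r.
rewrite -(Uiso x (T' y)); congr csum; apply/funext => n.
rewrite TE !UE T'E sgK !mul1r rmorphM /= mulrCA mulrA.
by congr (_ * _ * _); exact/esym/conj_realC.
Qed.

End Weighted.

Section Shifts.
Variable R : realType.
Implicit Types x y : ell2 R.

Lemma shift_operator (mu : nat -> R) (M : R) :
  0 <= M -> (forall n, mu n ^+ 2 <= M) ->
  exists S : boundedOp (ell2 R) (ell2 R),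
    forall x n, S x n = if n is k.+1 then (mu k)%:C * x k else 0.
Proof.
move=> M0 muM.
have [a f g [|n]|f|T TE] := @ell2_operator R
  (fun f n => if n is k.+1 then (mu k)%:C * f k else 0) M _ M0.
- by rewrite mulr0 addr0.
- by rewrite mulrDr mulrCA.
- rewrite {1}/esqnorm (esum_inj succn_inj) => [|[|n] h].
  + by apply: esqnorm_le => n; rewrite sqmod_real ler_wpM2r // sqmod_ge0.
  + by congr EFin; apply/eqP; rewrite sqmod_eq0.
  + by exfalso; apply: h; exists n.
- by exists T => x n; rewrite TE.
Qed.

Lemma shift_operator_weighted_shift (mu : nat -> R)
    (S : boundedOp (ell2 R) (ell2 R)) (M : R) :
  (forall n, 0 < mu n) -> (forall n, mu n <= M) ->
  (forall x n, S x n = if n is k.+1 then (mu k)%:C * x k else 0) ->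
  weighted_shift mu S.
Proof.
move=> mu0 muM SE; split=> //; first by exists M.
move=> n; apply/val_inj/funext => -[|k]; rewrite [LHS]SE.
  by rewrite -[RHS]/((mu n)%:C * 0) mulr0.
rewrite -[RHS]/((mu n)%:C * (k.+1 == n.+1)%:R) -[ell2_basis R n k]/((k == n)%:R) eqSS.
by case: eqP => [->//|_]; rewrite !mulr0.
Qed.

Let sqnorm_tail x (t : nat -> ell2 R) :
  (forall N n, t N n = if (n < N)%N then 0 else x n) ->
  limn (series (fun n => sqmod (t N n))) @[N --> \oo] --> (0 : R).
Proof.
move=> tE; set s := series (fun n => sqmod (x n)).
have E N : limn (series (fun n => sqmod (t N n))) = limn s - s N.
  apply: (cvg_lim (@Rhausdorff R)).
  have h : s n - s N @[n --> \oo] --> limn s - s N.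
    by apply: cvgB; [exact: ell2P | exact: cvg_cst].
  apply: cvg_trans h; apply: near_eq_cvg; exists N => // n /= Nn.
  rewrite /s !seriesEnat /= (big_cat_nat (n := N)) //= addrAC subrr add0r.
  rewrite [RHS](big_cat_nat (n := N)) //= [X in _ = X + _]big1_seq ?add0r.
    apply: eq_big_nat => i /andP[Ni _]; by rewrite tE ltnNge Ni.
  move=> i /andP[_]; rewrite mem_index_iota => /andP[_ iN].
  by rewrite tE iN; apply/eqP; rewrite sqmod_eq0.
under eq_fun do rewrite E.
have h : limn s - s N @[N --> \oo] --> limn s - limn s.
  by apply: cvgB; [exact: cvg_cst | exact: ell2P].
by rewrite subrr in h.
Qed.

Lemma bounded_ell2 (A : boundedOp (ell2 R) (ell2 R)) :
  exists M : R, forall x k, sqmod (A x k) <=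
    M * limn (series (fun n => sqmod (x n))).
Proof.
have [M AM] := bop_bounded A; exists (M ^+ 2) => x k; apply: le_trans (sqmod_le _ k) _.
have := AM x; rewrite /hnorm !ell2_normE => h.
rewrite -[X in X <= _](sqr_sqrtr (sqnorm_ge0 _)).
rewrite -[X in _ * X](sqr_sqrtr (sqnorm_ge0 _)).
rewrite -exprMn; apply: lerXn2r => //; rewrite nnegrE ?sqrtr_ge0 //.
by apply: le_trans h; exact: sqrtr_ge0.
Qed.

(** The finitely supported sequences are dense, so a weighted shift is given
    coordinatewise by the expected formula. *)
Lemma eq_on_basis (A B : boundedOp (ell2 R) (ell2 R)) :
  (forall n, A (ell2_basis R n) = B (ell2_basis R n)) -> forall x, A x = B x.
Proof.
move=> AB x.
have ex N : exists u : ell2 R, A u = B u /\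
    forall n, u n = if (n < N)%N then x n else 0.
  elim: N => [|N [u [Au uE]]]; first by exists 0; rewrite !raddf0.
  exists (u + x N *: ell2_basis R N); split.
    by rewrite !raddfD /= !linearZ /= AB Au.
  move=> n; rewrite -[LHS]/(u n + x N * (n == N)%:R) uE [in RHS]ltnS [in RHS]leq_eqVlt.
  case: (eqVneq n N) => [->|_]; first by rewrite ltnn mulr1 add0r.
  by rewrite mulr0 addr0.
have [u Hu] := choice ex.
pose t N : ell2 R := x - u N.
have tE N n : t N n = if (n < N)%N then 0 else x n.
  rewrite -[LHS]/(x n - u N n) (Hu N).2; case: ifP; rewrite ?subrr ?subr0 //.
have := sqnorm_tail tE; set L := (fun N => _) => L0.
have [MA hA] := bounded_ell2 A; have [MB hB] := bounded_ell2 B.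
apply/val_inj/funext => k.
apply/eqP; rewrite -subr_eq0 -sqmod_eq0 eq_le sqmod_ge0 andbT.
have h N : sqmod (A x k - B x k) <= (2 * MA + 2 * MB) * L N.
  have -> : A x k - B x k = A (t N) k + - B (t N) k.
    rewrite /t !raddfB /= (Hu N).1.
    by rewrite -[RHS]/((A x k - B (u N) k) + (- B x k - - B (u N) k)); ring.
  apply: le_trans (sqmodD _ _) _.
  have -> : sqmod (- B (t N) k) = sqmod (B (t N) k).
    by case: (B (t N) k) => a b; rewrite /sqmod /= !sqrrN.
  by have := hA (t N) k; have := hB (t N) k; rewrite /L; lra.
have c0 : (2 * MA + 2 * MB) * L N @[N --> \oo] --> (2 * MA + 2 * MB) * 0.
  by apply: cvgM; [exact: cvg_cst | exact: L0].
rewrite mulr0 in c0; rewrite -(cvg_lim (@Rhausdorff R) c0).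
by apply: limr_ge; [apply: cvgP; exact: c0 | exact: nearW].
Qed.

Lemma weighted_shiftE (lambda : nat -> R) (W : boundedOp (ell2 R) (ell2 R)) :
  weighted_shift lambda W ->
  forall x n, W x n = if n is k.+1 then (lambda k)%:C * x k else 0.
Proof.
move=> [l0 [M lM] We] x n.
have M0 : 0 <= M by apply: le_trans (lM 0%N); exact: ltW.
have [|k|S SE] := @shift_operator lambda (M ^+ 2).
- exact: sqr_ge0.
- by apply: lerXn2r; rewrite ?nnegrE // ltW.
have [_ _ Se] := shift_operator_weighted_shift l0 lM SE.
by rewrite (@eq_on_basis W S) ?SE // => m; rewrite We Se.
Qed.

End Shifts.

(** * Shifts with discrete Berger measure are subnormal *)

Lemma int_nat_bij : exists (io : int * nat -> nat) (ka : nat -> int * nat),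
  cancel io ka /\ cancel ka io.
Proof.
have inf : infinite_set [set: int * nat].
  move=> fin; apply: infinite_nat.
  have := @finite_preimage nat (int * nat)%type setT (fun n => (0, n)).
  by rewrite preimage_setT; apply => // m n _ _ [].
have /card_set_bijP[io] := eq_card_nat (countableP _) inf.
by rewrite setTT_bijective => -[ka h1 h2]; exists io, ka.
Qed.

Section PowerSumShift.
Variables (R : realType) (W r p : nat -> R) (th : R).
Variable S : boundedOp (ell2 R) (ell2 R).
Hypothesis W_ge0 : forall k, 0 <= W k.
Hypothesis r_bd : forall k, 0 <= r k <= th.
Hypothesis p_gt0 : forall n, 0 < p n.
Hypothesis pE : forall n, (\sum_(0 <= k <oo) (W k * r k ^+ n)%:E = (p n)%:E)%E.
Hypothesis SE : forall (x : ell2 R) n,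
  S x n = if n is k.+1 then (Num.sqrt (p k.+1 / p k))%:C * x k else 0.

Let coef n k : R := Num.sqrt (W k * r k ^+ n / p n).

Let coef_sqr n k : coef n k ^+ 2 = W k * r k ^+ n / p n.
Proof.
have [r0 _] := andP (r_bd k).
by rewrite sqr_sqrtr // divr_ge0 ?mulr_ge0 ?exprn_ge0 // ltW.
Qed.

Let coefS n k : Num.sqrt (p n.+1 / p n) * coef n.+1 k = Num.sqrt (r k) * coef n k.
Proof.
have [r0 _] := andP (r_bd k); rewrite -!sqrtrM //; last by rewrite divr_ge0 ?ltW.
congr Num.sqrt; rewrite exprS; field.
by rewrite ?(gt_eqF (p_gt0 _)).
Qed.

Let coef_sum n (a : R) : 0 <= a ->
  (\esum_(k in [set: nat]) (coef n k ^+ 2 * a)%:E = a%:E)%E.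
Proof.
move=> a0; have h0 k : 0 <= W k * r k ^+ n.
  by rewrite mulr_ge0 ?exprn_ge0 //; case/andP: (r_bd k).
rewrite -nneseries_esumT => [|k]; last first.
  by rewrite lee_fin mulr_ge0 // sqr_ge0.
under eq_eseriesr do rewrite coef_sqr mulrAC -mulrA mulrC EFinM.
rewrite nneseriesZl => [|k _]; last by rewrite lee_fin.
by rewrite pE -EFinM divfK // gt_eqF.
Qed.

(** The larger space is the sequence space indexed by [int * nat]; the normal
    extension is [N g (z, k) = sqrt (r k) * g (z - 1, k)], an orthogonal sum
    over [k] of multiples of the bilateral shift, and the vector [e_n] is
    embedded as the unit vector [(n, k) |-> sqrt (W k * r k ^ n / p n)]. *)
Lemma power_sum_shift_subnormal : subnormal S.
Proof.
have [io [ka [ioK kaK]]] := int_nat_bij.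
pose sg i := io ((ka i).1 - 1, (ka i).2).
pose ta i := io ((ka i).1 + 1, (ka i).2).
pose v i : R := Num.sqrt (r (ka i).2).
have sgK : cancel sg ta.
  by move=> i; rewrite /ta /sg ioK /= subrK -surjective_pairing kaK.
have taK : cancel ta sg.
  by move=> i; rewrite /ta /sg ioK /= addrK -surjective_pairing kaK.
have th0 : 0 <= th by case/andP: (r_bd 0) => /le_trans; exact.
have vE i : v i ^+ 2 <= th by case/andP: (r_bd (ka i).2) => ? ?; rewrite sqr_sqrtr.
have sgb : bijective sg by exists ta.
have tab : bijective ta by exists sg.
have [N NE] := weighted_comp_operator sgb th0 vE.
have [N' N'E] :=
  @weighted_comp_operator R (v \o ta) ta th tab th0 (fun i => vE (ta i)).
pose F (f : nat -> R[i]) i : R[i] :=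
  if ka i is (Posz n, k) then (coef n k)%:C * f n else 0.
have FE f : esqnorm (F f) = esqnorm f.
  pose e (u : nat * nat) := (Posz u.1, u.2).
  have ei : injective e by move=> [a b] [c d] [-> ->].
  rewrite {1}/esqnorm (reindex_esum [set: int * nat] setT io); last first.
    by rewrite setTT_bijective; exists ka.
  rewrite (esum_inj ei) => [|[[n|n] k] h]; last 2 first.
  - by exfalso; apply: h; exists (n, k).
  - by congr EFin; apply/eqP; rewrite sqmod_eq0 /F ioK.
  have -> : [set: nat * nat] = setT `*`` (fun _ : nat => [set: nat]).
    by apply/seteqP; split.
  under eq_esum do rewrite /F /e ioK sqmod_real.
  rewrite -(@esum_esum R _ _ setT (fun _ => setT)
    (fun n k => (coef n k ^+ 2 * sqmod (f n))%:E)).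
    by apply: eq_esum => n _; rewrite coef_sum // sqmod_ge0.
  by move=> n k _ _; rewrite lee_fin mulr_ge0 ?sqr_ge0 ?sqmod_ge0.
have [a f g i|f|V VE] := @ell2_operator R F 1 _ ler01.
- rewrite /F; case: (ka i) => -[n|n] k; last by rewrite mulr0 addr0.
  by rewrite mulrDr mulrCA.
- by rewrite mul1e FE.
exists (ell2 R), V, N; split.
- by apply: polarization => x; rewrite !inner_ell2 VE FE.
- exists N'; split.
    exact: weighted_comp_adjoint sgK taK NE N'E.
  move=> x; apply/val_inj/funext => i.
  by rewrite [LHS]NE N'E [RHS]N'E NE /= sgK taK /v {1}/ta ioK.
- move=> x; apply/val_inj/funext => i.
  rewrite -[RHS]/(ell2_fun (V (S x)) i) [LHS]NE 2!VE /F /sg ioK /v.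
  case: (ka i) => -[[|n]|n] k /=.
  + by rewrite SE !mulr0.
  + by rewrite subn1 SE !mulrA -!rmorphM /= -coefS [X in _ = X%:C * _]mulrC.
  + by rewrite mulr0.
Qed.

End PowerSumShift.

(** * Similarity of weighted shifts *)

(** The diagonal operator with entries [sqrt (p n / g n)] intertwines the two
    shifts, and comparability of [g] and [p] makes it and its inverse bounded. *)
Lemma shift_similar (R : realType) (lambda mu g p : nat -> R) (C : R)
    (W S : boundedOp (ell2 R) (ell2 R)) :
  (forall n, 0 < g n) -> (forall n, 0 < p n) ->
  (forall n, p n <= C * g n) -> (forall n, g n <= C * p n) ->
  (forall n, lambda n = Num.sqrt (g n.+1 / g n)) ->
  (forall n, mu n = Num.sqrt (p n.+1 / p n)) ->
  (forall (x : ell2 R) n, W x n = if n is k.+1 then (lambda k)%:C * x k else 0) ->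
  (forall (x : ell2 R) n, S x n = if n is k.+1 then (mu k)%:C * x k else 0) ->
  similar_op W S.
Proof.
move=> g0 p0 pg gp lE mE WE SE.
have C0 : 0 <= C.
  by rewrite -(pmulr_lge0 _ (g0 0%N)); apply: le_trans (pg 0%N); exact: ltW.
have bid : bijective (@id nat) by exists id.
have d (a b : nat -> R) : (forall n, 0 < b n) -> (forall n, 0 < a n) ->
    (forall n, a n <= C * b n) -> forall n, Num.sqrt (a n / b n) ^+ 2 <= C.
  by move=> b0 a0 ab n; rewrite sqr_sqrtr ?ler_pdivrMr // divr_ge0 ?ltW.
have [Y YE] := weighted_comp_operator bid C0 (d p g g0 p0 pg).
have [Z ZE] := weighted_comp_operator bid C0 (d g p p0 g0 gp).
have one n : Num.sqrt (p n / g n) * Num.sqrt (g n / p n) = 1.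
  rewrite -sqrtrM ?divr_ge0 ?ltW // -[RHS]sqrtr1; congr Num.sqrt; field.
  by rewrite ?(gt_eqF (p0 _)) ?(gt_eqF (g0 _)).
exists Y; split.
  exists Z => x; apply/val_inj/funext => n.
    by rewrite [LHS]ZE YE mulrA -rmorphM /= [X in X%:C]mulrC one mul1r.
  by rewrite [LHS]YE ZE mulrA -rmorphM /= one mul1r.
move=> x; apply/val_inj/funext => n.
rewrite [LHS]YE WE [RHS]SE; case: n => [|n]; first by rewrite mulr0.
rewrite YE !mulrA -!rmorphM /=; congr (_%:C * _); rewrite lE mE.
rewrite -!sqrtrM ?divr_ge0 ?ltW //; congr Num.sqrt; field.
by rewrite ?(gt_eqF (p0 _)) ?(gt_eqF (g0 _)).
Qed.

(** * Subnormality and moment sequences *)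

(** With [N] the normal extension and [A = N* N], the vectors [A ^ i h] have
    inner products [<A ^ i h, A ^ j h> = |N ^ (i + j) h| ^ 2 = g (i + j)], and
    the double sum is the squared norm of their linear combination. *)
Lemma subnormal_hankel (R : realType) (H : hilbertSpace R) (T : boundedOp H H)
    (h : H) (g : nat -> R) :
  subnormal T ->
  (forall n, inner H (iter n T h) (iter n T h) = (g n)%:C) ->
  forall (a : nat -> R) m,
    0 <= \sum_(i < m) \sum_(j < m) a i * a j * g (i + j)%N.
Proof.
move=> [K [V [N [iso [N' [adj comm]] NV]]]] gE a m.
pose v := V h; pose A x := N' (N x).
have itN n : iter n N v = V (iter n T h) by elim: n => //= n ->.
have adj' x y : inner K (N' x) y = inner K x (N y).
  have herm (u w : K) : inner K u w = (inner K w u)^* by rewrite hermC expr0 mul1r.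
  by rewrite herm -adj -herm.
have selfA x y : inner K (A x) y = inner K x (A y) by rewrite adj' adj.
have itA n : iter n A v = iter n N' (iter n N v).
  elim: n => //= n ->; rewrite /A; congr (N' _).
  by elim: n (iter n N v) => //= n IH z; rewrite comm IH.
have momA n : inner K (iter n A v) v = (g n)%:C.
  rewrite itA -gE -iso -itN.
  have shiftN k x y : inner K (iter k N' x) y = inner K x (iter k N y).
    by elim: k x y => // k IH x y; rewrite iterS adj' IH -iterSr.
  exact: shiftN.
have hank i j : inner K (iter i A v) (iter j A v) = (g (i + j)%N)%:C.
  rewrite -momA; elim: j i => [|j IH] i; first by rewrite addn0.
  by rewrite iterS -selfA -iterS IH addnS.
pose u : K := \sum_(i < m) (a i)%:C *: iter i A v.
have := dnorm_ge0 (inner K) u.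
have -> : inner K u u = (\sum_(i < m) \sum_(j < m) a i * a j * g (i + j)%N)%:C.
  rewrite linear_sumlz rmorph_sum; apply: eq_bigr => i _ /=.
  rewrite linear_sumr rmorph_sum; apply: eq_bigr => j _ /=.
  by rewrite linearZl_LR linearZr_LR /= hank conj_realC !rmorphM mulrA.
by rewrite lecE /= => /andP[].
Qed.

Section MomentFunctional.
Variables (R : realType) (E : {poly R} -> R) (A0 B c kap : R) (g : nat -> R).
Hypothesis E_lin : forall a p q, E (a *: p + q) = a * E p + E q.
Hypothesis gE : forall n, g n = A0 + B * n%:R + c * n%:R ^+ 2 + E ('X^n).
Hypothesis hankel : forall (a : nat -> R) m,
    0 <= \sum_(i < m) \sum_(j < m) a i * a j * g (i + j)%N.

(** The linear functional taking the monomials to the moments [g]. *)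
Let Lam p := A0 * p.[1] + B * (deriv p).[1]
  + c * ((deriv p).[1] + (deriv (deriv p)).[1]) + E p.

Let Lam_lin a p q : Lam (a *: p + q) = a * Lam p + Lam q.
Proof. by rewrite /Lam E_lin !derivD !derivZ !hornerD !hornerZ; ring. Qed.

Let Lam0 : Lam 0 = 0.
Proof. by have := Lam_lin 1 0 0; rewrite scale1r addr0 mul1r; lra. Qed.

Let LamX n : Lam 'X^n = g n.
Proof.
rewrite /Lam gE !derivXn hornerXn expr1n derivMn !hornerMn derivXn hornerMn.
rewrite !hornerXn !expr1n; congr (_ + _); case: n => [|n].
  by rewrite !mulr0n; ring.
by rewrite /= -[1 *+ n *+ n.+1]mulr_natr -natr1; ring.
Qed.

Let Lam_sqr h : 0 <= Lam (h * h).
Proof.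
have sumL (I : finType) (F : I -> {poly R}) : Lam (\sum_i F i) = \sum_i Lam (F i).
  apply: (big_morph Lam _ Lam0) => p q.
  by rewrite -[p]scale1r Lam_lin mul1r scale1r.
rewrite -{1 2}[h]coefK poly_def big_distrlr /= sumL.
under eq_bigr do rewrite sumL.
under eq_bigr do under eq_bigr do
  rewrite -scalerAl -scalerAr -exprD scalerA -[_ *: _]addr0 Lam_lin Lam0 addr0 LamX.
exact: (hankel (fun i => h`_i)).
Qed.

(** At 1 it has value 1, derivative [al] and second derivative [- 2 kap n];
    where [0 < kap (x - 1) ^ 2 <= 1] it decays geometrically in [n]. *)
Definition test_poly (al : R) n : {poly R} :=
  (1 + al *: ('X - 1)) * (1 - kap *: ('X - 1) ^+ 2) ^+ n.

Let Lam_test al n : Lam (test_poly al n * test_poly al n) =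
  A0 + 2 * B * al + c * (2 * al + 2 * al ^+ 2 - 4 * kap * n%:R)
  + E (test_poly al n * test_poly al n).
Proof.
have q0 : (1 - kap *: ('X - 1 : {poly R}) ^+ 2).[1] = 1.
  by rewrite !(hornerE, horner_exp) subrr /=; ring.
have E1 : (test_poly al n).[1] = 1.
  by rewrite /test_poly hornerM horner_exp q0 expr1n !hornerE subrr /=; ring.
have q1 : (deriv (1 - kap *: ('X - 1 : {poly R}) ^+ 2)).[1] = 0.
  by rewrite !derivCE !(hornerE, horner_exp) /=; ring.
have q2 : (deriv (deriv (1 - kap *: ('X - 1 : {poly R}) ^+ 2))).[1] = - (2 * kap).
  by rewrite !derivCE !(hornerE, horner_exp) /=; ring.
have E2 : (deriv (test_poly al n)).[1] = al.
  rewrite /test_poly derivM; move: (1 - _) q0 q1 q2 => q q0 q1 q2.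
  rewrite !derivCE !(hornerE, horner_exp, hornerMn) q0 q1 !expr1n subrr.
  by rewrite /= mul0r mul0rn; ring.
have E3 : (deriv (deriv (test_poly al n))).[1] = - (2 * kap * n%:R).
  rewrite /test_poly; move: (1 - _) q0 q1 q2 => q q0 q1 q2.
  rewrite !derivCE !(hornerE, horner_exp, hornerMn) q0 q1 !expr1n subrr.
  by rewrite /= !mul0r !mul0rn q2 -(mulr_natr (_ + _)); ring.
move: (test_poly al n) E1 E2 E3 => p E1 E2 E3.
by rewrite /Lam !derivCE !hornerE E1 E2 E3 /=; ring.
Qed.

Hypothesis kap_gt0 : 0 < kap.
Hypothesis c_ge0 : 0 <= c.
Hypothesis E_test : forall al e, 0 < e ->
  exists n0, forall n, (n0 <= n)%N -> E (test_poly al n * test_poly al n) <= e.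

(** On the squared test polynomials the functional tends, as [n] grows, to
    [- oo] if [c > 0], and to the affine function [A0 + 2 B al] of [al] if
    [c = 0]; it must stay nonnegative for all [al]. *)
Lemma moment_functional_rigid : [/\ c = 0, B = 0 & 0 <= A0].
Proof.
have bound al e : 0 < e -> exists n0, forall n, (n0 <= n)%N ->
    0 <= A0 + 2 * B * al + c * (2 * al + 2 * al ^+ 2 - 4 * kap * n%:R) + e.
  move=> /(E_test al)[n0 Hn]; exists n0 => n /Hn h.
  by have := Lam_sqr (test_poly al n); rewrite Lam_test; lra.
have c0 : c = 0.
  apply/eqP; rewrite eq_le c_ge0 andbT leNgt; apply/negP => c_gt0.
  have [n0 Hn] := bound 0 1 ltr01.
  have d0 : 0 < 4 * c * kap by rewrite !mulr_gt0.
  have [m Hm] : exists m : nat, (A0 + 1) / (4 * c * kap) < m%:R.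
    set z := _ / _; exists (Num.bound `|z|).
    exact: le_lt_trans (ler_norm z) (archi_boundP (normr_ge0 z)).
  have := Hn (maxn n0 m) (leq_maxl _ _).
  have : (m%:R : R) <= (maxn n0 m)%:R by rewrite ler_nat leq_maxr.
  move: ((maxn n0 m)%:R : R) => k mk; move: Hm; rewrite ltr_pdivrMr // => Hm.
  have : m%:R * (4 * c * kap) <= k * (4 * c * kap) by rewrite ler_pM2r.
  move=> h1; rewrite expr0n /= !mulr0 => h2; lra.
have lin al : 0 <= A0 + 2 * B * al.
  rewrite leNgt; apply/negP => neg.
  have [|n0 /(_ n0 (leqnn _))] := bound al (- (A0 + 2 * B * al) / 2); first by lra.
  by rewrite c0; lra.
have A0_ge0 : 0 <= A0 by have := lin 0; rewrite mulr0 addr0.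
split=> //; apply/eqP/negP => /negP B0.
have := lin (- (A0 + 1) / (2 * B)); rewrite leNgt => /negP; apply.
have -> : A0 + 2 * B * (- (A0 + 1) / (2 * B)) = -1 by field.
by rewrite oppr_lt0 ltr01.
Qed.

End MomentFunctional.

(** * Comparison of sequences *)

(** Writing [a = exp t ^ 4], the bound [exp (n t) >= 1 + n t] shows that [a ^ n]
    dominates a fourth power of [1 + n t], hence every quadratic in [n]. *)
Lemma quadratic_le_geometric (R : realType) (A0 B c a e : R) (s : nat -> R) :
  1 < a -> 0 < e -> (forall n, e * a ^+ n <= s n) ->
  exists N, forall n, (N <= n)%N ->
    2 * `|A0 + B * n%:R + c * n%:R ^+ 2| <= s n.
Proof.
move=> a1 e0 sa; pose t := ln a / 4.
have t0 : 0 < t by rewrite divr_gt0 // ln_gt0.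
have ra : a = expR t ^+ 4.
  rewrite -expRM_natl /t mulrC divfK ?lnK // posrE; exact: lt_trans ltr01 a1.
pose K := `|A0| + `|B| / t + `|c| / t ^+ 2.
pose z := 2 * K / e / t; exists (Num.bound `|z|) => n Nn.
set y := 1 + n%:R * t.
have y1 : 1 <= y by rewrite lerDl mulr_ge0 // ltW.
have y0 : 0 <= y by exact: le_trans ler01 y1.
have nz : z <= n%:R.
  apply: le_trans (ler_norm z) _; apply: le_trans (ltW (archi_boundP (normr_ge0 _))) _.
  by rewrite ler_nat.
have ny : n%:R <= y / t by rewrite ler_pdivlMr // lerDr.
have Ky : 2 * K <= e * y.
  move: nz; rewrite /z !ler_pdivrMr // => h.
  by apply: le_trans h _; rewrite mulrC ler_pM2l // lerDr.
have PK : `|A0 + B * n%:R + c * n%:R ^+ 2| <= K * y ^+ 2.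
  have y2 : y <= y ^+ 2 by rewrite expr2 ler_peMl.
  apply: le_trans (ler_normD _ _) _; rewrite !mulrDl; apply: lerD.
    apply: le_trans (ler_normD _ _) _; apply: lerD.
      by rewrite ler_peMr // (le_trans y1).
    rewrite normrM (@ger0_norm _ n%:R) // -mulrA ler_wpM2l //.
    by apply: le_trans ny _; rewrite mulrC ler_wpM2l // invr_ge0 ltW.
  rewrite normrM (@ger0_norm _ (n%:R ^+ 2)) ?exprn_ge0 // -mulrA ler_wpM2l //.
  rewrite mulrC -expr_div_n; apply: lerXn2r => //; rewrite nnegrE //.
  exact: le_trans (ler0n _ _) ny.
apply: le_trans (_ : e * y * y ^+ 2 <= _).
  apply: le_trans (_ : 2 * K * y ^+ 2 <= _); first by rewrite -mulrA ler_pM2l.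
  by rewrite ler_wpM2r // exprn_ge0.
apply: le_trans (sa n); rewrite -mulrA ler_pM2l // -exprS.
rewrite ra -exprM mulnC exprM -expRM_natl.
have yE : y <= expR (n%:R * t) by exact: expR_ge1Dx.
apply: le_trans (_ : y ^+ 4 <= _); last first.
  by apply: lerXn2r; rewrite ?nnegrE ?expR_ge0.
by rewrite ler_weXn2l.
Qed.

Lemma eventually_comparable (R : realType) (g s : nat -> R) (N : nat) :
  (forall n, 0 < g n) -> (forall n, 0 < s n) ->
  (forall n, (N <= n)%N -> g n <= 2 * s n /\ s n <= 2 * g n) ->
  exists C, [/\ 0 < C, forall n, g n <= C * s n & forall n, s n <= C * g n].
Proof.
move=> g0 s0 gs; pose C := 2 + \sum_(i < N) (g i / s i + s i / g i).
have pos i : 0 <= g i / s i + s i / g i by rewrite addr_ge0 // divr_ge0 // ltW.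
have C2 : 2 <= C by rewrite lerDl sumr_ge0.
have key n : (n < N)%N -> g n / s n <= C /\ s n / g n <= C.
  move=> nN; have h : g n / s n + s n / g n <= C.
    rewrite /C (bigD1 (Ordinal nN)) //= addrCA lerDl addr_ge0 // sumr_ge0 //.
  have h1 : 0 < g n / s n by rewrite divr_gt0.
  have h2 : 0 < s n / g n by rewrite divr_gt0.
  by split; apply: le_trans h; rewrite ?lerDl ?lerDr ltW.
exists C; split; first exact: lt_le_trans C2.
- move=> n; have [/gs[h _]|/key[h _]] := leqP N n; last by rewrite -ler_pdivrMr.
  by apply: le_trans h _; rewrite ler_pM2r.
- move=> n; have [/gs[_ h]|/key[_ h]] := leqP N n; last by rewrite -ler_pdivrMr.
  by apply: le_trans h _; rewrite ler_pM2r.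
Qed.

(** * Shifts with moments given by a positive functional *)

Section Moments.
Variables (R : realType) (E : {poly R} -> R) (a th : R).
Hypothesis E_lin : forall k p q, E (k *: p + q) = k * E p + E q.
Hypothesis E_le : forall p q : {poly R},
  (forall x, a <= x -> x <= th -> p.[x] <= q.[x]) -> E p <= E q.
Hypothesis E1_gt0 : 0 < E 1.
Hypothesis a_gt1 : 1 < a.
Hypothesis a_le_th : a <= th.

Variables (lambda : nat -> R) (W : boundedOp (ell2 R) (ell2 R)) (A0 B c : R).
Hypothesis shiftW : weighted_shift lambda W.
Hypothesis hatE : forall n,
  lambda_hat lambda n = A0 + B * n%:R + c * n%:R ^+ 2 + E 'X^n.

Let s n := E 'X^n.
Let g n := lambda_hat lambda n.

Let E0 : E 0 = 0.
Proof. by have := E_lin 1 0 0; rewrite scale1r addr0 mul1r; lra. Qed.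

Let EZ k p : E (k *: p) = k * E p.
Proof. by rewrite -[k *: p]addr0 E_lin E0 addr0. Qed.

Let EX_ge n : a * s n <= s n.+1.
Proof.
rewrite -EZ; apply: E_le => x ax _.
rewrite hornerZ !hornerXn exprS ler_wpM2r // exprn_ge0 //.
by apply: le_trans ax; apply: ltW; exact: lt_trans ltr01 _.
Qed.

Let EX_le n : s n.+1 <= th * s n.
Proof.
rewrite -EZ; apply: E_le => x ax xt.
rewrite hornerZ !hornerXn exprS ler_wpM2r // exprn_ge0 //.
by apply: le_trans ax; apply: ltW; exact: lt_trans ltr01 _.
Qed.

Let a_gt0 : 0 < a. Proof. exact: lt_trans ltr01 a_gt1. Qed.

Let s_geo n : E 1 * a ^+ n <= s n.
Proof.
elim: n => [|n IH]; first by rewrite mulr1 /s expr0.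
by apply: le_trans (EX_ge n); rewrite exprS mulrCA ler_pM2l.
Qed.

Let s_gt0 n : 0 < s n.
Proof. by apply: lt_le_trans (s_geo n); rewrite mulr_gt0 // exprn_gt0. Qed.

Let s_logconvex n : s n.+1 ^+ 2 <= s n * s n.+2.
Proof.
(* [E] of [(X - t) ^ 2 X^n], for the [t] that minimizes it. *)
pose t := s n.+1 / s n.
have : E 0 <= E ((t ^+ 2) *: 'X^n + ((- (2 * t)) *: 'X^(n.+1) + 'X^(n.+2))).
  apply: E_le => x ax _; rewrite horner0 !hornerD !hornerZ !hornerXn.
  have -> : t ^+ 2 * x ^+ n + (- (2 * t) * x ^+ n.+1 + x ^+ n.+2) =
    (t - x) ^+ 2 * x ^+ n by rewrite !exprS; ring.
  rewrite mulr_ge0 ?sqr_ge0 // exprn_ge0 //; apply: le_trans ax; exact: ltW.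
rewrite E0 !E_lin -!/(s _) => h.
have s0 := s_gt0 n; have : 0 <= s n * (t ^+ 2 * s n + (- (2 * t) * s n.+1 + s n.+2)).
  by rewrite mulr_ge0 // ltW.
have -> : s n.+1 = t * s n by rewrite /t divfK // gt_eqF.
move=> h'; rewrite -subr_ge0; apply: le_trans h' _.
by rewrite le_eqVlt; apply/orP; left; apply/eqP; ring.
Qed.

Let g_gt0 n : 0 < g n.
Proof. by case: shiftW => l0 _ _; apply: prodr_gt0 => i _; rewrite exprn_gt0. Qed.

Let lambdaE n : lambda n = Num.sqrt (g n.+1 / g n).
Proof.
case: shiftW => l0 _ _; rewrite /g /lambda_hat big_ord_recr /= mulrAC divff ?mul1r.
  by rewrite sqrtr_sqr gtr0_norm.
by rewrite gt_eqF // g_gt0.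
Qed.

Lemma similar_to_subnormal_shift :
  exists (mu : nat -> R) (S : boundedOp (ell2 R) (ell2 R)),
    [/\ weighted_shift mu S, subnormal S & similar_op W S].
Proof.
have [N HN] := quadratic_le_geometric A0 B c a_gt1 E1_gt0 s_geo.
have [|C1 [C1_gt0 gs sg]] := @eventually_comparable R g s N g_gt0 s_gt0.
  move=> n /HN; rewrite /g hatE -/(s n) => h.
  have := ler_norm (A0 + B * n%:R + c * n%:R ^+ 2).
  have := ler_norm (- (A0 + B * n%:R + c * n%:R ^+ 2)); rewrite normrN.
  by have := s_gt0 n; lra.
have [V [r [C [V0 r0 C_gt0 H]]]] := logconvex_power_sum s_gt0 s_logconvex EX_le.
pose f n k := V k * r k ^+ n.
have f0 n k : 0 <= f n k.
  by rewrite mulr_ge0 // exprn_ge0 //; case/andP: (r0 k).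
have fnd n : nondecreasing_seq (series (f n)).
  by apply: nondecreasing_series => k _ _.
have fE n K : series (f n) K = \sum_(k < K) V k * r k ^+ n by rewrite seriesEord.
have fub n K : series (f n) K <= C * s n by rewrite fE; have [h _] := H n.
have fcv n : cvgn (series (f n)).
  apply: nondecreasing_is_cvgn => //; exists (C * s n) => _ [K _ <-]; exact: fub.
pose p n := limn (series (f n)).
have ps n : p n <= C * s n by apply: limr_le => //; exact: nearW.
have sp n : s n <= C * p n.
  have [_ [K /le_trans]] := H n; apply; rewrite ler_pM2l //.
  by rewrite -fE; exact: nondecreasing_cvgn_le.
have p0 n : 0 < p n by rewrite -(pmulr_rgt0 _ C_gt0); exact: lt_le_trans (sp n).
have pE n : (\sum_(0 <= k <oo) (V k * r k ^+ n)%:E = (p n)%:E)%E.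
  by rewrite /p -EFin_lim //; congr (limn _); apply/funext => K; rewrite /= sumEFin.
have th0 : 0 <= th by apply: le_trans a_le_th; exact: ltW.
have pth n : p n.+1 / p n <= th.
  rewrite ler_pdivrMr //; apply: limr_le => //; apply: nearW => K.
  apply: le_trans (_ : th * series (f n) K <= _); last first.
    by rewrite ler_wpM2l //; exact: nondecreasing_cvgn_le.
  rewrite !seriesEord /= mulr_sumr; apply: ler_sum => k _.
  rewrite /f exprS mulrCA; case/andP: (r0 k) => r1 r2.
  by rewrite ler_wpM2r // mulr_ge0 // exprn_ge0.
pose mu n := Num.sqrt (p n.+1 / p n).
have mu0 n : 0 < mu n by rewrite sqrtr_gt0 divr_gt0.
have mu2 n : mu n ^+ 2 <= th by rewrite sqr_sqrtr // ltW // divr_gt0.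
have [S SE] := shift_operator th0 mu2.
exists mu, S; split.
- apply: (shift_operator_weighted_shift (M := Num.sqrt th)) SE => // n.
  exact: ler_wsqrtr.
- exact: (power_sum_shift_subnormal V0 r0 p0 pE SE).
- apply: (@shift_similar R lambda mu g p (C * C1)) g_gt0 p0 _ _ lambdaE _ _ SE => //.
  + move=> n; apply: le_trans (ps n) _; rewrite -mulrA ler_pM2l //; exact: sg.
  + move=> n; apply: le_trans (gs n) _; rewrite [C * C1]mulrC -mulrA ler_pM2l //.
  + exact: weighted_shiftE.
Qed.

Let W_iter n : iter n W (ell2_basis R 0) =
  (\prod_(i < n) lambda i)%:C *: ell2_basis R n.
Proof.
have [_ _ We] := shiftW; elim: n => [|n IH]; first by rewrite big_ord0 scale1r.
by rewrite iterS IH linearZ /= We scalerA big_ord_recr /= rmorphM.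
Qed.

Let basis_norm n : inner (ell2 R) (ell2_basis R n) (ell2_basis R n) = 1.
Proof.
rewrite inner_ell2 /esqnorm.
have -> : (\esum_(i in [set: nat]) (sqmod (ell2_basis R n i))%:E = 1)%E; last by [].
have e1 : ((sqmod (ell2_basis R n n))%:E = 1 :> \bar R)%E.
  by rewrite /= /ell2_basis_fun eqxx /sqmod /= expr1n expr0n addr0.
apply: etrans e1.
rewrite -(@esum_set1 _ _ n (fun i => (sqmod (ell2_basis R n i))%:E)); last first.
  by rewrite lee_fin sqmod_ge0.
rewrite [RHS]esum_mkcond; apply: eq_esum => i _; case: ifPn => //.
rewrite notin_setE /= => /eqP /negbTE; rewrite /ell2_basis_fun => ->.
by rewrite /sqmod /= expr0n addr0.
Qed.

Lemma subnormal_rigid : 0 <= c -> subnormal W -> [/\ c = 0, B = 0 & 0 <= A0].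
Proof.
move=> c0 subW.
have hankel := subnormal_hankel subW (h := ell2_basis R 0) (g := g).
have th0 : 0 < th by exact: lt_le_trans a_le_th.
(* [x - 1 <= th] on the support, so [th ^- 2 * (x - 1) ^ 2 <= 1] there. *)
apply: (@moment_functional_rigid R E A0 B c (th ^- 2) g) => //.
- apply: hankel => n; rewrite W_iter linearZl_LR linearZr_LR /= basis_norm mulr1.
  by rewrite conj_realC -rmorphM /= /g /lambda_hat prodrXl expr2.
- by rewrite invr_gt0 exprn_gt0.
move=> al e e0; pose rho := 1 - (a - 1) ^+ 2 / th ^+ 2.
have a10 : 0 < a - 1 by rewrite subr_gt0.
have rho1 : 0 <= rho < 1.
  rewrite subr_ge0 ler_pdivrMr ?exprn_gt0 // mul1r gtrBl divr_gt0 ?exprn_gt0 // andbT.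
  by have tha := a_le_th; apply: lerXn2r; rewrite ?nnegrE; lra.
pose M := (1 + `|al| * th) ^+ 2.
have M0 : 0 <= M by exact: sqr_ge0.
have bound n : E (test_poly (th ^- 2) al n * test_poly (th ^- 2) al n) <=
    M * E 1 * rho ^+ n.
  rewrite [M * _ * _]mulrAC -(EZ (M * rho ^+ n) 1); apply: E_le => x ax xt.
  rewrite hornerZ hornerC mulr1 hornerM /test_poly hornerM horner_exp.
  have -> : (1 + al *: ('X - 1)).[x] = 1 + al * (x - 1) by rewrite !hornerE.
  have -> : (1 - th ^- 2 *: ('X - 1) ^+ 2).[x] = 1 - th ^- 2 * (x - 1) ^+ 2.
    by rewrite !(hornerE, horner_exp).
  set u := 1 + _; set v := 1 - _.
  have x1 : 0 < x - 1 by lra.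
  have uM : u ^+ 2 <= M.
    rewrite -real_normK ?num_real //; apply: lerXn2r; rewrite ?nnegrE //.
      by rewrite addr_ge0 // mulr_ge0 // ltW.
    apply: le_trans (ler_normD _ _) _; rewrite normr1 lerD2l normrM ler_wpM2l //.
    by rewrite gtr0_norm //; lra.
  have [v0 vrho] : 0 <= v /\ v <= rho.
    rewrite /v /rho subr_ge0 mulrC ler_pdivrMr ?exprn_gt0 // mul1r lerD2l lerN2.
    split; first by apply: lerXn2r; rewrite ?nnegrE; lra.
    rewrite ler_pM2r ?invr_gt0 ?exprn_gt0 //.
    by apply: lerXn2r; rewrite ?nnegrE; lra.
  have -> : u * v ^+ n * (u * v ^+ n) = u ^+ 2 * (v ^+ n * v ^+ n) by ring.
  have vn0 := exprn_ge0 n v0.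
  apply: ler_pM => //; [exact: sqr_ge0 | exact: mulr_ge0 |].
  have vr : v ^+ n <= rho ^+ n by apply: lerXn2r; rewrite ?nnegrE // (le_trans v0).
  apply: le_trans vr; rewrite ler_piMr // exprn_ile1 //.
  by case/andP: rho1 => _ /ltW; exact: le_trans.
have cr : M * E 1 * rho ^+ n @[n --> \oo] --> M * E 1 * 0.
  apply: cvgM; first exact: cvg_cst.
  by apply: cvg_expr; case/andP: rho1 => ? ?; rewrite ger0_norm.
rewrite mulr0 in cr; move/cvgrPdist_le : cr => /(_ e e0)[n0 _ Hn].
exists n0 => n /Hn /=; rewrite sub0r normrN => h.
by apply: le_trans (bound n) _; apply: le_trans h; exact: ler_norm.
Qed.

End Moments.

(** * Integration over the support *)

Section SupportMeasure.
Variables (R : realType) (nu : {finite_measure set (measurableTypeR R) -> \bar R}).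

(** Every point off the support lies in a null interval with rational
    end points, and there are only countably many of these. *)
Lemma negligible_setC_msupport : nu.-negligible (~` msupport nu).
Proof.
pose U (k : nat) : set (measurableTypeR R) :=
  if unpickle k is Some (p, q) then
    let I : set R := [set` `]ratr p : R, ratr q[ ] in
    if nu I == 0%E then I else set0
  else set0.
apply: (@negligibleS _ _ _ _ (\bigcup_k U k)).
  move=> x /existsNP[V /not_implyP[[Vo Vx] nuV]].
  have [p [q [px xq pqV]]] : exists p q : rat, [/\ ratr p < x, x < ratr q &
      [set` `]ratr p : R, ratr q[ ] `<=` V].
    have /nbhs_ballP[e /= e0 eV] : nbhs x V by exact: open_nbhs_nbhs.
    have [|p /itvP pe] := @rat_in_itvoo _ (x - e) x; first by rewrite ltrBlDr ltrDl.
    have [|q /itvP qe] := @rat_in_itvoo _ x (x + e); first by rewrite ltrDl.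
    exists p, q; split; rewrite ?pe ?qe // => y /itvP hy; apply: eV.
    rewrite /ball /= ltr_distlC; apply/andP; split.
      by apply: (@lt_trans _ _ (ratr p)); rewrite ?pe ?hy.
    by apply: (@lt_trans _ _ (ratr q)); rewrite ?qe ?hy.
  exists (pickle (p, q)); [exact: I | rewrite /U pickleK].
  have -> : nu [set` `]ratr p : R, ratr q[ ] == 0%E.
    rewrite eq_le measure_ge0 andbT; apply: le_trans (_ : nu V <= _)%E.
      apply: le_measure => //; rewrite inE //; exact: open_measurable.
    by rewrite leNgt; apply/negP.
  by rewrite /= in_itv /= px.
apply: negligible_bigcup => k; rewrite /U.
case: unpickle => [[p q]|]; last exact: negligible_set0.
case: ifPn => [/eqP h|_]; last exact: negligible_set0.
by apply/negligibleP.
Qed.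

Hypothesis supp_compact : compact (msupport nu).
Hypothesis supp_inf_gt1 : 1 < supp_inf nu.

Let a := supp_inf nu.
Let th := supp_sup nu.
Let D : set (measurableTypeR R) := [set` `[a, th]].
Let w (x : R) : R := ((x - 1) ^+ 2)^-1.

Lemma msupport_neq0 : msupport nu !=set0.
Proof.
apply/set0P/eqP => s0; move: supp_inf_gt1.
by rewrite /supp_inf s0 inf0 ltr10.
Qed.

Let supp_bounded : has_lbound (msupport nu) /\ has_ubound (msupport nu).
Proof.
have [M [_ /(_ (M + 1))]] := compact_bounded supp_compact.
rewrite ltrDl ltr01 => /(_ isT) h; split.
  by exists (- (M + 1)) => x /h /= /ler_normlP[hx _]; rewrite lerNl.
by exists (M + 1) => x /h /= /ler_normlP[].
Qed.

Lemma msupport_sub_itv : msupport nu `<=` [set` `[a, th]].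
Proof.
move=> x sx; rewrite /= in_itv /=; apply/andP; split.
  by apply: ge_inf => //; case: supp_bounded.
by apply: ub_le_sup => //; case: supp_bounded.
Qed.

Lemma supp_inf_le_sup : supp_inf nu <= supp_sup nu.
Proof.
have [x /msupport_sub_itv] := msupport_neq0.
by rewrite /= in_itv /= => /andP[]; exact: le_trans.
Qed.

Let a_le_th : a <= th. Proof. exact: supp_inf_le_sup. Qed.

Let mD : measurable D. Proof. exact: measurable_itv. Qed.

Let nuDC : nu (~` D) = 0%E.
Proof.
apply/negligibleP; first exact: measurableC.
apply: negligibleS negligible_setC_msupport.
by apply: subsetC; exact: msupport_sub_itv.
Qed.

Let nuD_gt0 : (0 < nu D)%E.
Proof.
have [x sx] := msupport_neq0; have : (0 < nu setT)%E.
  by apply: sx; split; [exact: openT | ].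
have -> : nu setT = (nu D + nu (~` D))%E.
  rewrite -(setUv D) measureU //; [exact: measurableC | exact: setICr].
by rewrite nuDC adde0.
Qed.

(** As [nu] vanishes off [D], integrability over [D] passes to [X]. *)
Let integral_restrict (X : set (measurableTypeR R)) (f : R -> R) :
  measurable X -> D `<=` X -> measurable_fun X f -> nu.-integrable D (EFin \o f) ->
  (\int[nu]_(x in X) (f x)%:E = \int[nu]_(x in D) (f x)%:E)%E.
Proof.
move=> mX DX mf iD.
have mC : measurable (~` D) by exact: measurableC.
have XD : X `\` (~` D) = D by rewrite setDE setCK; exact/setIidPr.
rewrite (negligible_integral mC mX _ nuDC) ?XD //.
apply/(negligible_integrable mC mX _ nuDC); rewrite ?XD //.
exact/measurable_EFinP.
Qed.

Let mw X : measurable_fun X w.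
Proof.
have -> : w = (fun x => ((x - 1) ^+ 2) `^ (- 1)).
  by apply/funext => x; rewrite powR_inv1 // sqr_ge0.
apply: (measurableT_comp (measurable_powR _)).
by apply: measurable_funX; apply: measurable_funB.
Qed.

Let mpw X (p : {poly R}) : measurable_fun X (fun x => p.[x] * w x).
Proof. by apply: measurable_funM => //; exact: measurable_poly. Qed.

Let w_bd x : D x -> 0 < (th - 1) ^- 2 <= w x /\ w x <= (a - 1) ^- 2.
Proof.
rewrite /D /= in_itv /= => /andP[ax xt].
have a1 : 0 < a - 1 by rewrite subr_gt0.
have x1 : 0 < x - 1 by apply: lt_le_trans a1 _; rewrite lerB.
have t1 : 0 < th - 1 by apply: lt_le_trans x1 _; rewrite lerB.
rewrite invr_gt0 exprn_gt0 //= /w !lef_pV2 ?posrE ?exprn_gt0 //.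
by split; apply: lerXn2r; rewrite ?nnegrE ?(ltW a1) ?(ltW x1) ?(ltW t1) ?lerB.
Qed.

Let poly_bd (p : {poly R}) : exists M, forall x, D x -> `|p.[x]| <= M.
Proof.
exists (\sum_(i < size p) `|p`_i| * th ^+ i) => x.
rewrite /D /= in_itv /= => /andP[ax xt].
rewrite horner_coef; apply: le_trans (ler_norm_sum _ _ _) _.
apply: ler_sum => i _; rewrite normrM ler_wpM2l // normrX.
have x0 : 0 <= x by apply: le_trans ax; apply: ltW; exact: lt_trans ltr01 _.
by rewrite ger0_norm //; apply: lerXn2r => //; rewrite nnegrE // (le_trans x0).
Qed.

Let ipw (p : {poly R}) : nu.-integrable D (EFin \o (fun x => p.[x] * w x)).
Proof.
apply: measurable_bounded_integrable => //.
  by rewrite ltey_eq fin_num_measure.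
  exact: mpw.
have [M HM] := poly_bd p; exists (M * (a - 1) ^- 2); split; first exact: num_real.
move=> N MN x /= Dx; apply: le_trans (ltW MN); rewrite normrM.
have [/andP[w0 wl] wu] := w_bd Dx; have w1 := lt_le_trans w0 wl.
by apply: ler_pM => //; [exact: HM | rewrite gtr0_norm].
Qed.

(** Over [D] the weight [w] is bounded, as [D] stays away from 1. *)
Definition weighted_integral (p : {poly R}) : R :=
  (\int[nu]_(x in D) (p.[x] * w x))%R.
Local Notation E := weighted_integral.

Let EE p : (\int[nu]_(x in D) (p.[x] * w x)%:E = (E p)%:E)%E.
Proof.
have h := integrable_fin_num mD (ipw p).
by rewrite /E /Rintegral fineK; last exact h.
Qed.

Lemma weighted_integral_lin k p q : E (k *: p + q) = k * E p + E q.
Proof.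
have iD := ipw p; have iq := ipw q.
rewrite /E -RintegralZl // -RintegralD //; last first.
  have := ipw (k *: p); congr (_.-integrable _ _); apply/funext => x /=.
  by rewrite hornerZ mulrA.
by apply: eq_Rintegral => x _; rewrite hornerD hornerZ; ring.
Qed.

Lemma weighted_integral_le p q :
  (forall x, a <= x -> x <= th -> p.[x] <= q.[x]) -> E p <= E q.
Proof.
move=> pq; apply: le_Rintegral => // x Dx.
have [/andP[w0 wl] _] := w_bd Dx; rewrite ler_wpM2r ?(le_trans (ltW w0)) //.
by move: Dx; rewrite /D /= in_itv /= => /andP[]; exact: pq.
Qed.

Lemma weighted_integral1_gt0 : 0 < E 1.
Proof.
apply: (@lt_le_trans _ _ ((th - 1) ^- 2 * fine (nu D))).
  have [x /msupport_sub_itv /w_bd[/andP[t0 _] _]] := msupport_neq0.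
  by rewrite mulr_gt0 // fine_gt0 // nuD_gt0 ltey_eq fin_num_measure.
rewrite -(Rintegral_cst nu mD); apply: le_Rintegral => //.
  by apply: finite_measure_integrable_cst.
by move=> x Dx; rewrite hornerC mul1r; have [/andP[]] := w_bd Dx.
Qed.

Let D_gt1 x : D x -> 1 < x.
Proof. by rewrite /D /= in_itv /= => /andP[ax _]; exact: lt_le_trans ax. Qed.

Lemma integral_lt1 : (\int[nu]_(x in `[0%R, 1%R[) (w x)%:E = 0)%E.
Proof.
rewrite (ge0_negligible_integral (measurableC mD) _ _ _ nuDC) //=.
- rewrite (_ : _ `\` _ = set0) ?integral_set0 // setDE setCK.
  rewrite -subset0 => x [/=]; rewrite in_itv /= => /andP[_ x1] /D_gt1.
  by rewrite ltNge ltW.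
- by apply/measurable_EFinP; exact: mw.
- by move=> x _; rewrite lee_fin invr_ge0 sqr_ge0.
Qed.

Lemma integral_gt1 : (\int[nu]_(x in `]1%R, th]) (w x)%:E = (E 1)%:E)%E.
Proof.
rewrite integral_restrict //.
- by rewrite -EE; apply: eq_integral => x _; rewrite hornerC mul1r.
- move=> x Dx; have := D_gt1 Dx; move: Dx.
  by rewrite /D /= !in_itv /= => /andP[_ ->] ->.
- exact: mw.
- have := ipw 1; congr (_.-integrable _ _); apply/funext => x /=.
  by rewrite hornerC mul1r.
Qed.

Let D_ge0 : D `<=` `[0%R, +oo[.
Proof. by move=> x /D_gt1 x1; rewrite /= in_itv /= andbT ltW // (lt_trans ltr01). Qed.

Lemma integral_inv :
  (\int[nu]_(x in `[0%R, +oo[) ((x - 1)^-1)%:E = (E ('X - 1))%:E)%E.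
Proof.
have XE x : (x - 1)^-1 = ('X - 1).[x] * w x.
  rewrite !hornerE /w /=; have [->|x1] := eqVneq (x - 1) 0.
    by rewrite invr0 mul0r.
  by field.
rewrite integral_restrict //.
- by rewrite -EE; apply: eq_integral => x _; rewrite XE.
- have := @mpw `[0%R, +oo[ ('X - 1); congr measurable_fun.
  by apply/funext => x; rewrite XE.
- by have := ipw ('X - 1); congr (_.-integrable _ _); apply/funext => x /=; rewrite XE.
Qed.

(** By induction, from the recursion [Q_(n+1) = n + x Q_n]. *)
Lemma Qpoly_sqr n (x : R) : (x - 1) ^+ 2 * Qpoly n x = x ^+ n - 1 - n%:R * (x - 1).
Proof.
have QS m : Qpoly m.+1 x = m%:R + x * Qpoly m x.
  rewrite /Qpoly /=; case: m => [|m]; first by rewrite !big_ord0 mulr0 addr0.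
  rewrite big_ord_recl expr0 mulr1 subn0 subn1 /=; congr (_ + _).
  rewrite big_distrr /=; apply: eq_bigr => i _.
  by rewrite /bump /= add1n subSS exprS mulrCA.
elim: n => [|n IH]; first by rewrite /Qpoly big_ord0 expr0; ring.
by rewrite QS mulrDr mulrCA IH [in RHS]exprS -natr1; ring.
Qed.

Lemma integral_Qpoly n :
  (\int[nu]_(x in `[0%R, +oo[) (Qpoly n x)%:E =
   (E 'X^n - E 1 - n%:R * E ('X - 1))%:E)%E.
Proof.
have -> : E 'X^n - E 1 - n%:R * E ('X - 1) =
    E ((- n%:R) *: ('X - 1) + ((- 1) *: 1 + 'X^n)).
  by rewrite !weighted_integral_lin; ring.
have QE x : D x -> Qpoly n x = ((- n%:R) *: ('X - 1) + ((- 1) *: 1 + 'X^n)).[x] * w x.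
  move=> /D_gt1 x1; have x0 : (x - 1) ^+ 2 != 0.
    by rewrite expf_neq0 // subr_eq0 gt_eqF.
  apply: (mulfI x0); rewrite Qpoly_sqr /w mulrCA divff // mulr1.
  by rewrite !hornerE /=; ring.
have mQ : measurable_fun (`[0, +oo[ : set (measurableTypeR R)) (@Qpoly R n).
  have -> : @Qpoly R n = horner (\sum_(j < n.-1) (n - j - 1)%N%:R *: 'X^j).
    apply/funext => x; rewrite horner_sum; apply: eq_bigr => j _.
    by rewrite hornerZ hornerXn.
  exact: measurable_poly.
rewrite integral_restrict //.
- by rewrite -EE; apply: eq_integral => x; rewrite inE => Dx; rewrite QE.
- apply: eq_integrable (ipw ((- n%:R) *: ('X - 1) + ((- 1) *: 1 + 'X^n))) => //.
  by move=> x; rewrite inE => Dx /=; rewrite QE.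
Qed.

Lemma not_msupport_sub0 : ~ (msupport nu `<=` [set 0]).
Proof.
have [x sx] := msupport_neq0 => /(_ x sx) /= x0.
have /D_gt1 := msupport_sub_itv sx; by rewrite x0 ltNge ler01.
Qed.

End SupportMeasure.

Local Close Scope complex_scope.

Theorem theorem3p2p2 (R : realType) (lambda : nat -> R)
    (W : boundedOp (ell2 R) (ell2 R)) (b c : R)
    (nu : {finite_measure set (measurableTypeR R) -> \bar R})
    (shiftW : weighted_shift lambda W)
    (cpdW : cpd_op W)
    (tripletW : scalar_triplet lambda b c nu)
    (b_ge0 : 0 <= b)
    (hyp :
      (* (i) *)
      [/\ b + c >= 1,
          2 * c + mass nu * (1 - c) >= b,
          mass nu >= 1 &
          supp_inf nu >= 2 * (1 + c)]
      \/
      (* (ii) *)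
      (exists t : R, 0 < t /\
        [/\ b + c + mass nu * t * (1 + t) >= 1,
            2 * c + mass nu * (1 - 2 * t - 3 / 2 * t ^+ 2) >= b,
            mass nu * t * (2 + t) >= 2 * c &
            supp_inf nu >= 2 + t])
      \/
      (* (iii) *)
      (exists t tau : R, [/\ 0 < t, 0 < tau & tau < 1] /\
        [/\ b + c >= tau,
            2 * c + mass nu * (1 - t / 2) >= tau * b &
            mass nu * t >= 2 * tau * c] /\
        [/\ b + c <= supp_sup nu - 1,
            2 * c + mass nu <= (supp_sup nu - 1) * b,
            (1 - tau) * supp_sup nu < 1 &
            supp_inf nu >= 1 + tau + t])) :
  shift_type_III lambda b c nu /\
  (exists (mu : nat -> R) (S : boundedOp (ell2 R) (ell2 R)),
     [/\ weighted_shift mu S, subnormal S & similar_op W S]) /\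
  ((* (a) *)
   ((1 - \int[nu]_(x in `]1%R, (supp_sup nu)]) (((x - 1) ^+ 2)^-1)%:E
       < \int[nu]_(x in `[0%R, 1%R[) (((x - 1) ^+ 2)^-1)%:E)%E /\
    (\int[nu]_(x in `[0%R, 1%R[) (((x - 1) ^+ 2)^-1)%:E <= +oo)%E)
   \/
   (* (b) *)
   b%:E <> (\int[nu]_(x in `[0%R, +oo[) ((x - 1)^-1)%:E)%E
   \/
   (* (c) *)
   0 < c ->
   ~ subnormal W).
Proof.
have [c0 _ cpt _ hatE0] := tripletW.
have a1 : 1 < supp_inf nu.
  case: hyp => [[_ _ _ h]|[[t [t0 [_ _ _ h]]]|[t [tau [[t0 tau0 _] [_ [_ _ _ h]]]]]]];
    by apply: lt_le_trans h; lra.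
pose E := weighted_integral nu.
have E_lin := weighted_integral_lin a1.
have E_le := weighted_integral_le a1.
have E1 := weighted_integral1_gt0 cpt a1.
have ath := supp_inf_le_sup cpt a1.
have hatE n : lambda_hat lambda n =
    (1 - E 1) + (b - E ('X - 1)) * n%:R + c * n%:R ^+ 2 + E 'X^n.
  have := hatE0 n; rewrite (integral_Qpoly cpt a1) -EFinD => -[->].
  by rewrite -/E; ring.
split; first by split=> //; left; exact: not_msupport_sub0 cpt a1.
split; first exact: (similar_to_subnormal_shift E_lin E_le E1 a1 ath shiftW hatE).
move=> cond subW.
have [c_eq0 B_eq0 A0_ge0] := subnormal_rigid E_lin E_le a1 ath shiftW hatE c0 subW.
case: cond => [[h _]|[h|h]].
- move: h; rewrite (integral_gt1 cpt a1) (integral_lt1 cpt a1) -EFinB lte_fin.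
  by rewrite ltNge A0_ge0.
- apply: h; rewrite (integral_inv cpt a1); congr EFin.
  by apply/eqP; rewrite -subr_eq0 B_eq0.
- by rewrite c_eq0 ltxx in h.
Qed.
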